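(* Let $s\in\mathbb R$ and $1<p<\infty$. The following hold. (i) For all $r$ with $p<r\le\infty$, $$\dot F^s_{p,r}\setminus\dot{\mathcal B}^s_p(0,\infty)\neq\emptyset.$$ (ii) For all $r$ with $0<r<p$, $$\dot{\mathcal B}^s_p(0,1)\setminus\dot F^s_{p,r}\neq\emptyset.$$
   Context: Lorentz spaces: for a measure space $(\Omega,\mu)$ and $1<p<\infty$, $1\le r<\infty$, $L^{p,r}(\Omega,\mu)$ is the space of measurable $g$ with $[g]_{L^{p,r}}=\big(r\int_0^\infty\lambda^r\mu(\{|g|>\lambda\})^{r/p}\frac{d\lambda}{\lambda}\big)^{1/r}<\infty$, and $[g]_{L^{p,\infty}}=\sup_{\lambda>0}\lambda\,\mu(\{|g|>\lambda\})^{1/p}$; $\|\cdot\|_{L^{p,r}}$ denotes a norm equivalent to this quasi-norm. Let $d\ge1$. Fix a radial $\varphi\in C_c^\infty(\mathbb R^d)$ with $\mathrm{supp}\,\varphi\subset\{3/4<|\xi|<7/4\}$, $\varphi=1$ on $\{7/8\le|\xi|\le9/8\}$ and $\sum_{k\in\mathbb Z}\varphi(2^{-k}\xi)=1$ for $\xi\ne0$; put $\widehat{L_kf}(\xi)=\varphi(2^{-k}\xi)\widehat f(\xi)$. $\mathcal S_\infty(\mathbb R^d)$ is the space of Schwartz functions whose Fourier transforms vanish to infinite order at $0$; its dual $\mathcal S_\infty'(\mathbb R^d)$ is identified with tempered distributions modulo polynomials. For $\gamma\in\mathbb R$ let $\mu_\gamma(E)=\sum_{k\in\mathbb Z}2^{-k\gamma}\int_{\mathbb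 R^d}\mathbf 1_E(x,k)\,dx$ on $\mathbb R^d\times\mathbb Z$, and $P^bf(x,k)=2^{kb}L_kf(x)$. $\dot{\mathcal B}^s_p(\gamma,r)$ is the space of $f\in\mathcal S_\infty'(\mathbb R^d)$ with $\|f\|_{\dot{\mathcal B}^s_p(\gamma,r)}=\|P^{s+\gamma/p}f\|_{L^{p,r}(\mathbb R^d\times\mathbb Z,\mu_\gamma)}<\infty$; here this is used with $\gamma=0$. $\dot F^s_{p,r}$ is the space of $f\in\mathcal S_\infty'(\mathbb R^d)$ with $\big\|\big(\sum_{k\in\mathbb Z}2^{ksr}|L_kf|^r\big)^{1/r}\big\|_{L^p}<\infty$ (supremum over $k$ if $r=\infty$). *)

(* Defs.v *)
From HB Require Import structures.
From mathcomp Require Import all_boot all_order all_algebra.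
From mathcomp Require Import complex.
From mathcomp Require Import all_classical all_reals all_analysis.

Set Implicit Arguments.
Unset Strict Implicit.
Unset Printing Implicit Defensive.

Import Order.TTheory GRing.Theory Num.Theory.
Import numFieldNormedType.Exports.
Import ComplexField.Normc.

Local Open Scope classical_set_scope.
Local Open Scope ring_scope.
Local Open Scope complex_scope.

Local Notation cre := (@complex.Re _).
Local Notation cim := (@complex.Im _).

HB.instance Definition _ := isPointed.Build int 0.
HB.instance Definition _ := @isMeasurable.Build default_measure_display
  int discrete_measurable discrete_measurable0
  discrete_measurableC discrete_measurableU.

(* The sigma-algebra on R^d generated by the coordinates, i.e. the Borel one. *)
Section measurable_rV.
Context {R : realType} {d : nat}.

Definition rV_coord (i : 'I_d) (x : 'rV[R]_d) : measurableTypeR R := x ord0 i.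

Let rV_set0 : g_sigma_preimage rV_coord set0.
Proof. exact: sigma_algebra0. Qed.

Let rV_setC A : g_sigma_preimage rV_coord A -> g_sigma_preimage rV_coord (~` A).
Proof. exact: sigma_algebraC. Qed.

Let rV_bigcup (F : (set 'rV[R]_d)^nat) :
  (forall i, g_sigma_preimage rV_coord (F i)) ->
  g_sigma_preimage rV_coord (\bigcup_i (F i)).
Proof. exact: sigma_algebra_bigcup. Qed.

HB.instance Definition _ := @isMeasurable.Build default_measure_display
  'rV[R]_d (g_sigma_preimage rV_coord) rV_set0 rV_setC rV_bigcup.

Lemma measurable_rV_coord (i : 'I_d) : measurable_fun setT (rV_coord i).
Proof.
move=> _ Y mY; rewrite setTI; apply: sub_sigma_algebra => /=.
rewrite -bigcup_seq/=; exists i => /=; first by rewrite mem_index_enum.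
by exists Y => //; rewrite setTI.
Qed.

Lemma measurable_fun_rVP d1 (T1 : measurableType d1) (f : T1 -> 'rV[R]_d) :
  (forall i, measurable_fun setT (rV_coord i \o f)) -> measurable_fun setT f.
Proof.
move=> mf _ A mA; rewrite setTI.
have : <<s \big[setU/set0]_(i < d) preimage_set_system setT (rV_coord i) measurable >>
    `<=` [set B | measurable (f @^-1` B)].
  apply: smallest_sub.
    split => /=.
    - by rewrite preimage_set0; exact: measurable0.
    - by move=> B mB; rewrite setTD preimage_setC; exact: measurableC.
    - by move=> F mF; rewrite preimage_bigcup; exact: bigcupT_measurable.
  move=> B; rewrite -bigcup_seq => -[i _ [C mC <-]] /=.
  by rewrite setTI -comp_preimage -[X in measurable X]setTI; exact: mf.
exact.
Qed.

End measurable_rV.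

Section lebesgue_rV.
Context {R : realType}.

Definition rV_cons d (z : measurableTypeR R * 'rV[R]_d) : 'rV[R]_(1 + d) :=
  row_mx (\row__ (z.1 : R)) z.2.

Lemma measurable_rV_cons d : measurable_fun setT (@rV_cons d).
Proof.
apply: measurable_fun_rVP => i.
rewrite /rV_cons; case: (split_ordP i) => j ->.
  rewrite (_ : _ \o _ = fst) ; first exact: measurable_fst.
  by apply/funext => z /=; rewrite /rV_coord row_mxEl mxE.
rewrite (_ : _ \o _ = rV_coord j \o snd).
  by apply: measurableT_comp => //; exact: measurable_rV_coord.
by apply/funext => z /=; rewrite /rV_coord row_mxEr.
Qed.

Definition rV_uncons d (x : 'rV[R]_(1 + d)) : measurableTypeR R * 'rV[R]_d :=
  (lsubmx x ord0 ord0, rsubmx x).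

Lemma measurable_rV_uncons d : measurable_fun setT (@rV_uncons d).
Proof.
apply: measurable_fun_pair.
  rewrite (_ : (fun _ => _) = rV_coord (lshift d ord0)).
    exact: measurable_rV_coord.
  by apply/funext => x /=; rewrite mxE.
apply: measurable_fun_rVP => i.
rewrite (_ : _ \o _ = rV_coord (rshift 1 i)); first exact: measurable_rV_coord.
by apply/funext => x /=; rewrite /rV_coord/= mxE.
Qed.

Lemma rV_consK d : cancel (@rV_cons d) (@rV_uncons d).
Proof. by move=> [a x]; rewrite /rV_uncons/rV_cons row_mxKl row_mxKr mxE. Qed.

Lemma rV_unconsK d : cancel (@rV_uncons d) (@rV_cons d).
Proof.
move=> x; rewrite /rV_uncons/rV_cons/= -[RHS]hsubmxK; congr row_mx.
by apply/rowP => i; rewrite (ord1 i) !mxE.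
Qed.

Section step.
Context (d : nat) (m : {sigma_finite_measure set 'rV[R]_d -> \bar R}).

Definition lebesgue_rV_succ : set 'rV[R]_(1 + d) -> \bar R :=
  pushforward (@lebesgue_measure R \x m)%E (@rV_cons d).

Let succ0 : lebesgue_rV_succ set0 = 0%E.
Proof. by rewrite /lebesgue_rV_succ /pushforward preimage_set0 measure0. Qed.

Let succ_ge0 A : (0 <= lebesgue_rV_succ A)%E.
Proof. by rewrite /lebesgue_rV_succ /pushforward; exact: (measure_ge0 (_ \x m)%E). Qed.

Let succ_sigma_additive : semi_sigma_additive lebesgue_rV_succ.
Proof.
move=> F mF tF mUF; rewrite /lebesgue_rV_succ /pushforward preimage_bigcup.
have mcons B : measurable B -> measurable (@rV_cons d @^-1` B).
  by move=> mB; rewrite -[X in measurable X]setTI; exact: measurable_rV_cons.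
apply: measure_semi_sigma_additive.
- by move=> n; exact: mcons.
- apply/trivIsetP => i j _ _ ij; rewrite -preimage_setI.
  by move/trivIsetP : tF => /(_ _ _ _ _ ij) ->//; rewrite preimage_set0.
- by rewrite -preimage_bigcup; exact: mcons.
Qed.

HB.instance Definition _ := isMeasure.Build _ _ _
  lebesgue_rV_succ succ0 succ_ge0 succ_sigma_additive.

Let succ_sigma_finite : sigma_finite setT lebesgue_rV_succ.
Proof.
have /sigma_finiteP[F [TF ndF Foo]] := sigma_finiteT (@lebesgue_measure R).
have /sigma_finiteP[G [TG ndG Goo]] := sigma_finiteT m.
exists (fun n => @rV_uncons d @^-1` (F n `*` G n)).
  rewrite -preimage_bigcup (_ : \bigcup_n _ = setT) ?preimage_setT//.
  apply/seteqP; split=> // -[x y] _.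
  have [n _ Fnx] : (\bigcup_n F n) x by rewrite -TF.
  have [k _ Gky] : (\bigcup_n G n) y by rewrite -TG.
  exists (maxn n k) => //; split.
  - by move: x Fnx; exact/subsetPset/ndF/leq_maxl.
  - by move: y Gky; exact/subsetPset/ndG/leq_maxr.
move=> k; have [mF Fk] := Foo k; have [mG Gk] := Goo k.
have mFG : measurable (F k `*` G k) by exact: measurableX.
split.
  by rewrite -[X in measurable X]setTI; exact: measurable_rV_uncons.
rewrite /lebesgue_rV_succ /pushforward -comp_preimage.
rewrite (_ : _ \o _ = id) ?preimage_id; last exact/funext/rV_consK.
by rewrite product_measure1E// lte_mul_pinfty// ge0_fin_numE.
Qed.

HB.instance Definition _ := Measure_isSigmaFinite.Build _ _ _
  lebesgue_rV_succ succ_sigma_finite.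

End step.

(* Lebesgue measure on R^d, as an iterated product. *)
Fixpoint lebesgue_rV (d : nat) : {sigma_finite_measure set 'rV[R]_d -> \bar R} :=
  match d with
  | 0 => dirac (0 : 'rV[R]_0)
  | d'.+1 => lebesgue_rV_succ (lebesgue_rV d')
  end.

End lebesgue_rV.

Section weighted_measure.
Context {R : realType} (d : nat) (gamma : R).

Definition mu_gamma (E : set ('rV[R]_d * int)) : \bar R :=
  \esum_(k in [set: int])
    ((2 `^ (- (k%:~R * gamma)))%:E * lebesgue_rV d [set x | E (x, k)])%E.

Let mu_gamma0 : mu_gamma set0 = 0%E.
Proof. by apply: esum1 => k _; rewrite measure0 mule0. Qed.

Let term_ge0 E k :
  (0 <= (2 `^ (- (k%:~R * gamma)))%:E * lebesgue_rV d [set x | E (x, k)])%E.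
Proof. by rewrite mule_ge0// lee_fin powR_ge0. Qed.

Let mu_gamma_ge0 E : (0 <= mu_gamma E)%E.
Proof. by apply: esum_ge0 => k _; exact: term_ge0. Qed.

Let mu_gamma_sigma_additive : semi_sigma_additive mu_gamma.
Proof.
move=> F mF tF mUF.
have mFk n k : measurable [set x | F n (x, k)].
  by have := measurable_ysection k (mF n); rewrite ysectionE.
suff -> : mu_gamma (\bigcup_n F n) = (\sum_(0 <= n <oo) mu_gamma (F n))%E.
  by apply: is_cvg_nneseries => n _ _; exact: mu_gamma_ge0.
rewrite nneseries_esumT; last by move=> n; exact: mu_gamma_ge0.
rewrite /mu_gamma esum_esum; last by move=> *; exact: term_ge0.
transitivity (\esum_(k in [set: int]) \esum_(n in [set: nat])
    ((2 `^ (- (k%:~R * gamma)))%:E * lebesgue_rV d [set x | F n (x, k)])%E).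
  apply: eq_esum => k _; rewrite -nneseries_esumT => [|n]; last exact: term_ge0.
  rewrite nneseriesZl//; congr (_ * _)%E.
  rewrite -measure_semi_bigcup//=.
  - apply/trivIsetP => i j _ _ ij; move/trivIsetP : tF => /(_ _ _ _ _ ij) Fij.
    apply/seteqP; split=> // x [Fi Fj].
    by have : (F i `&` F j) (x, k) by []; rewrite Fij.
  - exact: bigcupT_measurable.
rewrite esum_esum; last by move=> *; exact: term_ge0.
apply: (reindex_esum _ _ (fun z : nat * int => (z.2, z.1))).
split => //=.
- by move=> [n k] [n' k'] _ _ [-> ->].
- by move=> [k n] _; exists (n, k).
Qed.

HB.instance Definition _ := isMeasure.Build _ _ _
  mu_gamma mu_gamma0 mu_gamma_ge0 mu_gamma_sigma_additive.

End weighted_measure.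

Section complex_calculus.
Context {R : realType} (d : nat).
Implicit Types (u : 'rV[R]_d -> R) (g : 'rV[R]_d -> R[i]).

Definition dotp (x y : 'rV[R]_d) : R := \sum_i x ord0 i * y ord0 i.

(* The norm of the normed module 'rV[R]_d is the sup norm. *)
Definition enorm (x : 'rV[R]_d) : R := Num.sqrt (dotp x x).

Definition partials (al : seq 'I_d) u : 'rV[R]_d -> R :=
  foldr (fun i v x => 'D_(delta_mx ord0 i) v x) u al.

Definition cpartials (al : seq 'I_d) g (x : 'rV[R]_d) : R[i] :=
  partials al (cre \o g) x +i* partials al (cim \o g) x.

Definition csmooth g := forall (al : seq 'I_d) (x : 'rV[R]_d),
  differentiable (partials al (cre \o g)) x /\
  differentiable (partials al (cim \o g)) x.

Definition supp g : set 'rV[R]_d := closure [set x | g x != 0].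

Definition Cc_infty : set ('rV[R]_d -> R[i]) :=
  [set g | csmooth g /\ compact (supp g)].

Definition cexpi (t : R) : R[i] := cos t +i* sin t.

Definition cintegral g : R[i] :=
  (\int[lebesgue_rV d]_x cre (g x))%R +i*
  (\int[lebesgue_rV d]_x cim (g x))%R.

Definition fourier g (xi : 'rV[R]_d) : R[i] :=
  cintegral (fun x => g x * cexpi (- (2 * pi * dotp x xi))).

Definition schwartz_norm (N : nat) g : \bar R :=
  ereal_sup [set ((1 + enorm z.2) ^+ N * normc (cpartials z.1 g z.2))%:E |
    z in [set z : seq 'I_d * 'rV[R]_d | (size z.1 <= N)%N]].

Definition schwartz : set ('rV[R]_d -> R[i]) :=
  [set g | csmooth g /\ forall N, (schwartz_norm N g < +oo)%E].

Definition schwartz_infty : set ('rV[R]_d -> R[i]) :=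
  [set g | schwartz g /\ forall al, cpartials al (fourier g) 0 = 0].

(* Continuous linear functionals on schwartz_infty, represented by functions
   defined on all of 'rV[R]_d -> R[i]; the values outside schwartz_infty are
   irrelevant. *)
Definition schwartz_infty_dual : set (('rV[R]_d -> R[i]) -> R[i]) :=
  [set f |
    (forall (a : R[i]) g h, schwartz_infty g -> schwartz_infty h ->
      f (fun x => a * g x + h x) = a * f g + f h) /\
    exists (N : nat) (C : R), forall g, schwartz_infty g ->
      ((normc (f g))%:E <= C%:E * schwartz_norm N g)%E].

End complex_calculus.

Section littlewood_paley.
Context {R : realType} (d : nat).
Implicit Types (phi : 'rV[R]_d -> R[i]) (f : ('rV[R]_d -> R[i]) -> R[i]).

Record lp_cutoff phi : Prop := LPCutoff {
  lp_smooth : Cc_infty phi ;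
  lp_radial : exists phi0 : R -> R[i], forall xi, phi xi = phi0 (enorm xi) ;
  lp_supp : supp phi `<=` [set xi | 3 / 4 < enorm xi < 7 / 4] ;
  lp_one : forall xi, 7 / 8 <= enorm xi <= 9 / 8 -> phi xi = 1 ;
  (* The support condition makes this sum finite for every xi. *)
  lp_sum : forall xi, xi != 0 ->
    \sum_(k \in [set: int]) phi ((2 : R) ^ (- k) *: xi) = 1 }.

Definition dist_fourier f : ('rV[R]_d -> R[i]) -> R[i] :=
  fun g => f (fourier g).

(* phi (2^-k _) * (dist_fourier f) is compactly supported, so its inverse
   Fourier transform L_k f is the function whose value at x is obtained by
   testing against xi |-> e^(2 i pi <x, xi>). *)
Definition LP phi (k : int) f (x : 'rV[R]_d) : R[i] :=
  dist_fourier f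
    (fun xi => phi ((2 : R) ^ (- k) *: xi) * cexpi (2 * pi * dotp x xi)).

Definition LPb phi (b : R) f (z : 'rV[R]_d * int) : R[i] :=
  (2 `^ (z.2%:~R * b))%:C * LP phi z.2 f z.1.

End littlewood_paley.

Section lorentz.
Context {R : realType} d (T : measurableType d).
Local Open Scope ereal_scope.

(* Finiteness of this quasi-norm defines the same space as finiteness of an
   equivalent norm. The value for r = -oo is a dummy. *)
Definition lorentz_qnorm (mu : {measure set T -> \bar R}) (p : R) (r : \bar R)
    (g : T -> R[i]) : \bar R :=
  match r with
  | r%:E => (r%:E * \int[@lebesgue_measure R]_(l in `]0%R, +oo[)
      ((l `^ r)%:E * mu [set x | (l < normc (g x))%R] `^ (r / p) * (l^-1)%:E))
        `^ r^-1
  | +oo => ereal_sup [set l%:E * mu [set x | (l < normc (g x))%R] `^ p^-1 |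
      l in `]0%R, +oo[]
  | -oo => +oo
  end.

Definition lorentz (mu : {measure set T -> \bar R}) (p : R) (r : \bar R) :
    set (T -> R[i]) :=
  [set g : T -> R[i] | [/\ measurable_fun setT (cre \o g),
              measurable_fun setT (cim \o g) &
              lorentz_qnorm mu p r g < +oo]].

End lorentz.

Section spaces.
Context {R : realType} (d : nat) (phi : 'rV[R]_d -> R[i]).

Definition besov_lorentz (s p gamma : R) (r : \bar R) :
    set (('rV[R]_d -> R[i]) -> R[i]) :=
  [set f | schwartz_infty_dual f /\
    lorentz (@mu_gamma R d gamma) p r (LPb phi (s + gamma / p) f)].

(* The value for r = -oo is a dummy. *)
Definition tl_fun (s : R) (r : \bar R) (f : ('rV[R]_d -> R[i]) -> R[i])
    (x : 'rV[R]_d) : \bar R :=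
  match r with
  | r%:E => ((\esum_(k in [set: int])
      (2 `^ (k%:~R * s * r) * normc (LP phi k f x) `^ r)%:E) `^ r^-1)%E
  | +oo%E => ereal_sup [set (2 `^ (k%:~R * s) * normc (LP phi k f x))%:E |
      k in [set: int]]
  | -oo%E => +oo%E
  end.

Definition triebel_lizorkin (s p : R) (r : \bar R) :
    set (('rV[R]_d -> R[i]) -> R[i]) :=
  [set f | schwartz_infty_dual f /\
    ('N[lebesgue_rV d]_p%:E[tl_fun s r f] < +oo)%E].

End spaces.

(* Main.v *)
(* Both witnesses are lacunary series sum_n c_n 2^(-n s) exp(2 i pi 2^n x_1) E_n(x),
   where the envelopes E_n are nonnegative, bounded below on a unit cube, dominated
   by one bounded integrable majorant W, and band-limited so strongly that L_n
   selects exactly the n-th summand. Then 2^(n s) |L_n f| = c_n E_n, so the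
   F-quantity is comparable to the l^r norm of c, and the mu_0-measure of the set
   {2^(k s) |L_k f| > l} is comparable to the number of n with c_n > l. For
   c_n = (n+1)^(-a) the l^r norm is finite iff a r > 1, whereas the weak l^p
   quasi-norm is infinite for a < 1/p and the l^(p,1) quasi-norm finite for a > 1/p.

   A distribution is evaluated on Fourier transforms of the cutoffs; Fubini moves
   that transform to the packets, whose own transforms are explicit triangles
   because the packets are products of Fejer kernels. No Fourier inversion is
   needed. *)
Require Import Defs.
From mathcomp Require Import all_boot all_order all_algebra.
From mathcomp Require Import complex.
From mathcomp Require Import all_classical all_reals all_analysis.
From mathcomp Require Import measurable_realfun ring lra zify.
Import Order.TTheory GRing.Theory Num.Theory.
Import numFieldNormedType.Exports.
Import ComplexField.Normc.
Local Open Scope classical_set_scope.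
Local Open Scope ring_scope.
Local Open Scope complex_scope.
Set Implicit Arguments.
Unset Strict Implicit.
Unset Printing Implicit Defensive.
Local Notation cre := (@complex.Re _).
Local Notation cim := (@complex.Im _).

(** * Lebesgue integrals on the line and the Fejer kernel *)

(** For very negative [s] the coefficients 2^(-n s) grow geometrically, so the bare series need not
    converge against a Schwartz function. Each packet is therefore paired with an [M]-th difference
    of the test function, with [M] at least 1 - s. The price is that the envelope becomes a sum of
    translates of one kernel; since that kernel is nonnegative there is no cancellation, and since
    all shifts are at most [M] one majorant serves every n. Fejer kernels suit this because their
    transforms reduce to a scaling argument and to elementary primitives, while their decay x^(-2)
    in each coordinate already makes the majorant W integrable. As W has no compact support, the
    level sets cannot be bounded above by counting over a fixed set. With c_n = (n+1)^(-1/t) the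
    count is made pointwise: c_n W(x) > l for at most (W(x)/l)^t indices, and W^t is integrable when
    t >= 1. Thus t = max(1, r) in the second half, where r may be smaller than 1. *)

Section line_integrals.
Context {R : realType}.
Implicit Types (f : R -> R).
Local Notation mu := (@lebesgue_measure R).

Lemma lebesgue_measureM (c : R) (A : set R) : 0 < c -> measurable A ->
  (c%:E * mu ( *%R c @^-1` A))%E = mu A.
Proof.
move=> c0 mA; apply/esym.
have mc : measurable_fun setT ( *%R c : measurableTypeR R -> measurableTypeR R).
  by apply: continuous_measurable_fun; exact: mulrl_continuous.
pose c' : {nonneg R} := NngNum (ltW c0).
pose pf : {measure set (measurableTypeR R) -> \bar R} :=
  mscale c' (measure_function_pushforward__canonical__measure_function_Measure mu mc).
rewrite (@lebesgue_measure_unique _ pf)//= => _ [[a b]] _ <-.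
rewrite /pf/= /mscale/= /pushforward.
rewrite (_ : _ @^-1` _ = `]a / c, b / c]%classic); last first.
  by apply/seteqP; split=> x /=; rewrite !in_itv/= ltr_pdivrMr// ler_pdivlMr// mulrC.
rewrite !lebesgue_measure_itv/= !lte_fin ltr_pM2r ?invr_gt0//.
case: ifPn => _; last by rewrite mule0.
by rewrite -EFinM mulrDr mulrN !(mulrC c) !divfK ?gt_eqF.
Qed.

Lemma ge0_integral_dilation (c : R) (f : R -> \bar R) : 0 < c ->
  measurable_fun setT f -> (forall x, 0 <= f x)%E ->
  (\int[mu]_x f x = c%:E * \int[mu]_x f (c * x)%R)%E.
Proof.
move=> c0 mf f0.
have mc : measurable_fun setT ( *%R c : measurableTypeR R -> measurableTypeR R).
  by apply: continuous_measurable_fun; exact: mulrl_continuous.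
have := @ge0_integral_pushforward _ _ _ _ _ _ mc mu setT f measurableT mf
  (fun y _ => f0 y).
rewrite preimage_setT /comp => <-.
pose c' : {nonneg R} := NngNum (ltW c0).
have -> : c = c'%:num by [].
rewrite -ge0_integral_mscale//.
apply: eq_measure_integral => /= A mA _; rewrite /mscale/= /pushforward.
by rewrite (lebesgue_measureM c0).
Qed.

Lemma Rintegral_opp f : mu.-integrable setT (EFin \o f) ->
  \int[mu]_x f (- x) = \int[mu]_x f x.
Proof.
move=> fi.
have mf : measurable_fun setT f by apply/measurable_EFinP; exact: measurable_int fi.
have mN : measurable_fun setT (-%R : measurableTypeR R -> measurableTypeR R).
  exact: oppr_measurable.
have NE (g : R -> \bar R) : (\int[mu]_x g x =
    \int[pushforward mu (-%R : measurableTypeR R -> measurableTypeR R)]_x g x)%E.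
  apply: (eq_measure_integral
    (measure_function_pushforward__canonical__measure_function_Measure mu mN)).
  by move=> /= A mA _; exact/esym/lebesgue_measureN.
congr fine.
rewrite [RHS]NE.
rewrite (@integral_pushforward _ _ _ _ _ _ mN) ?preimage_setT//.
  exact/measurable_EFinP.
apply/integrableP; split.
  by apply/measurable_EFinP; exact: measurableT_comp.
have /integrableP[_] := fi.
rewrite NE ge0_integral_pushforward//.
by do 2 apply: measurableT_comp => //; exact/measurable_EFinP.
Qed.

Lemma Rintegral_odd f : mu.-integrable setT (EFin \o f) ->
  (forall x, f (- x) = - f x) -> \int[mu]_x f x = 0.
Proof.
move=> fi fN; have := Rintegral_opp fi.
under eq_Rintegral do rewrite fN -mulN1r.
by rewrite RintegralZl// mulN1r => ?; lra.
Qed.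

Lemma integrable_oneDsqrV : mu.-integrable setT (fun x => ((1 + x ^+ 2)^-1)%:E).
Proof.
apply/integrableP; split.
  by apply/measurable_EFinP; apply: continuous_measurable_fun => x; exact: continuous_oneDsqrV.
under eq_integral do rewrite gee0_abs ?lee_fin ?invr_ge0 ?addr_ge0 ?sqr_ge0//.
rewrite (@ge0_symfun_integralT _ (fun x => (1 + x ^+ 2)^-1))//.
- have := integral0y_oneDsqr R; rewrite set_itvE => ->.
  by rewrite -EFinM ltry.
- by move=> x; rewrite invr_ge0 addr_ge0 ?sqr_ge0.
- exact: continuous_oneDsqrV.
- by move=> x /=; rewrite sqrrN.
Qed.

Lemma Rintegral_FTC (F f : R^o -> R^o) (a b : R) : a < b ->
  (forall x : R^o, is_derive x (1 : R^o) F (f x)) -> continuous f ->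
  \int[mu]_(x in `[a, b]) f x = F b - F a.
Proof.
move=> ab dF cf.
have cF : continuous F.
  by move=> x; apply/differentiable_continuous/derivable1_diffP; have [] := dF x.
rewrite /Rintegral (@continuous_FTC2 _ _ F)//.
- exact: continuous_subspaceT.
- split.
  + by move=> x _; have [] := dF x.
  + by apply: cvg_at_right_filter; exact: cF.
  + by apply: cvg_at_left_filter; exact: cF.
- by move=> x _; rewrite derive1E; have [_ ->] := dF x.
Qed.

End line_integrals.

Section fejer.
Context {R : realType}.
Local Notation mu := (@lebesgue_measure R).

Lemma normr_sin_le (x : R) : `|sin x| <= `|x|.
Proof.
wlog x0 : x / 0 <= x => [H|].
  have [/H//|/ltW x0] := leP 0 x.
  by rewrite -normrN -sinN -[leRHS]normrN H// oppr_ge0.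
have [c _] := @MVT_segment R sin cos 0 x x0 (fun y _ => is_derive_sin y)
  (continuous_subspaceT (@continuous_sin R)).
rewrite sin0 !subr0 => ->; rewrite normrM ler_piMl//.
exact: cos_max.
Qed.

Lemma one_sub_cos_ge0 (x : R) : 0 <= 1 - cos x.
Proof. by rewrite subr_ge0 cos_le1. Qed.

Lemma one_sub_cos_le2 (x : R) : 1 - cos x <= 2.
Proof. by have := cos_geN1 x; lra. Qed.

Lemma one_sub_cos_le_sqr (x : R) : 1 - cos x <= x ^+ 2 / 2.
Proof.
have -> : 1 - cos x = 2 * sin (x / 2) ^+ 2.
  have {1}-> : x = (x / 2) *+ 2 by rewrite -mulr_natr divfK.
  by have := cos2Dsin2 (x / 2); rewrite cos_mulr2n; lra.
have : sin (x / 2) ^+ 2 <= (x / 2) ^+ 2.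
  by rewrite -[leLHS]real_normK ?num_real// -[leRHS]real_normK ?num_real// lerXn2r ?nnegrE// normr_sin_le.
by rewrite exprMn; lra.
Qed.

(* At [y = 0] the value is [0], not the limit [delta ^+ 2 / 2]. *)
Definition fejer (delta y : R) : R := (1 - cos (delta * y)) / y ^+ 2.

Lemma fejer_ge0 delta y : 0 <= fejer delta y.
Proof. by rewrite divr_ge0 ?one_sub_cos_ge0 ?sqr_ge0. Qed.

(** Multiplying the kernel by [1 + y ^+ 2] gives the sum of [(1 - cos (delta * y)) / y ^+ 2], at
    most [delta ^+ 2 / 2] by the quadratic bound, and of [1 - cos (delta * y)], at most 2. *)
Lemma fejer_le delta y : fejer delta y <= (delta ^+ 2 / 2 + 2) * (1 + y ^+ 2)^-1.
Proof.
have ? : 0 < 1 + y ^+ 2 by rewrite ltr_pwDl// sqr_ge0.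
have [->|y0] := eqVneq y 0.
  rewrite /fejer mulr0 cos0 subrr mul0r mulr_ge0//.
    by rewrite addr_ge0// divr_ge0// sqr_ge0.
have y20 : 0 < y ^+ 2 by rewrite exprn_even_gt0.
rewrite ler_pdivlMr// /fejer -mulrA [_^-1 * _]mulrDr mulr1 mulVf ?gt_eqF//.
rewrite mulrDr mulr1 lerD// ?one_sub_cos_le2//.
rewrite ler_pdivrMr// (le_trans (one_sub_cos_le_sqr _))// exprMn.
by rewrite mulrAC.
Qed.

Lemma measurable_sqrV : measurable_fun setT (fun y : R => (y ^+ 2)^-1).
Proof.
rewrite (_ : (fun _ => _) = (fun y : R => y `^ (- 1)) \o (fun y => y ^+ 2)).
  by apply: measurableT_comp; [exact: measurable_powR|exact: exprn_measurable].
by apply/funext => y /=; rewrite powR_inv1// sqr_ge0.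
Qed.

Lemma measurable_cos_affine (a b : R) :
  measurable_fun setT (fun y : R => cos (a * y + b)).
Proof.
apply: continuous_measurable_fun => y; apply: continuous_comp => /=.
  by apply: cvgD; [exact: mulrl_continuous|exact: cvg_cst].
exact: continuous_cos.
Qed.

Lemma measurable_fejer delta : measurable_fun setT (fejer delta).
Proof.
apply: measurable_funM; last exact: measurable_sqrV.
apply: measurable_funB => //; have := measurable_cos_affine delta 0.
by under eq_fun do rewrite addr0.
Qed.

Lemma integrable_fejer delta : mu.-integrable setT (EFin \o fejer delta).
Proof.
apply: (le_integrable measurableT _ _
  (integrableZl measurableT (delta ^+ 2 / 2 + 2) integrable_oneDsqrV)).
  by apply/measurable_EFinP; exact: measurable_fejer.
move=> y _ /=; rewrite lee_fin ger0_norm ?fejer_ge0//.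
exact: le_trans (fejer_le _ _) (ler_norm _).
Qed.

Lemma integrable_fejer_cos delta (a b : R) :
  mu.-integrable setT (fun y => (fejer delta y * cos (a * y + b))%:E).
Proof.
apply: (le_integrable measurableT _ _ (integrable_fejer delta)).
  apply/measurable_EFinP/measurable_funM; first exact: measurable_fejer.
  exact: measurable_cos_affine.
by move=> y _ /=; rewrite lee_fin normrM ler_piMr// cos_max.
Qed.

(** The value is pi. It is carried along as a positive constant, which avoids evaluating the
    improper integral. *)
Definition fejer_mass : R := \int[mu]_y fejer 1 y.

(** On [1, 2] the kernel is at least [(1 - cos 1) / 4], because cosine decreases there (2 <= pi) and
    the denominator is at most 4. *)
Lemma fejer_mass_gt0 : 0 < fejer_mass.
Proof.
have c1 : 0 < 1 - cos (1 : R).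
  have pi2 := pi_ge2 R.
  by rewrite subr_gt0 -[ltRHS]cos0 ltr_cos ?in_itv//=; lra.
have : (((1 - cos 1) / 4)%:E * mu `[1%R, 2%R] <= \int[mu]_y (fejer 1 y)%:E)%E.
  rewrite -integral_cst// integral_mkcond.
  apply: ge0_le_integral => //.
  - move=> y _; rewrite patchE; case: ifP => // _.
    by rewrite lee_fin divr_ge0// ltW.
  - by apply/measurable_restrict => //; rewrite setTI; apply: measurable_cst.
  - by apply/measurable_EFinP; exact: measurable_fejer.
  - move=> y _; rewrite patchE; case: ifPn => [|_]; last by rewrite lee_fin fejer_ge0.
    rewrite inE/= in_itv/= => /andP[y1 y2]; rewrite lee_fin /fejer mul1r.
    have := pi_ge2 R => pi2.
    apply: ler_pM; [exact: one_sub_cos_ge0|by []| |].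
      rewrite lerD2l lerN2; move: y1; rewrite le_eqVlt => /predU1P[<-//|y1].
      by rewrite ltW// ltr_cos// in_itv/=; lra.
    by rewrite lef_pV2 ?posrE ?exprn_gt0//; nra.
rewrite lebesgue_measure_itv/= lte_fin ltr1n/= -EFinB -EFinM.
rewrite -(@fineK _ (\int[mu]_y _)%E) ?lee_fin; last first.
  by apply: integrable_fin_num => //; exact: integrable_fejer.
by apply: lt_le_trans; lra.
Qed.

(** For [t > 0] the kernel [fejer t y] equals [t ^+ 2 * fejer 1 (t * y)], and undoing the dilation
    costs one factor [t]; evenness in [t] gives the absolute value. *)
Lemma Rintegral_fejer (t : R) : \int[mu]_y fejer t y = `|t| * fejer_mass.
Proof.
have fejerN s y : fejer (- s) y = fejer s y by rewrite /fejer mulNr cosN.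
wlog t0 : t / 0 <= t => [H|].
  have [/H//|/ltW t0] := leP 0 t.
  rewrite -[t]opprK; under eq_Rintegral do rewrite fejerN.
  by rewrite H ?oppr_ge0// opprK normrN.
move: t0; rewrite le_eqVlt => /predU1P[<-|t0].
  rewrite normr0 mul0r; under eq_Rintegral do rewrite /fejer mul0r cos0 subrr mul0r.
  by rewrite /Rintegral integral0.
rewrite gtr0_norm//.
have dil : (\int[mu]_y (fejer 1 y)%:E = t%:E * \int[mu]_y (fejer 1 (t * y))%:E)%E.
  apply: (@ge0_integral_dilation _ t (fun y => (fejer 1 y)%:E)) => //.
    by apply/measurable_EFinP; exact: measurable_fejer.
  by move=> y; rewrite lee_fin fejer_ge0.
have mt : measurable_fun setT (fun y => fejer 1 (t * y)).
  apply: measurableT_comp; first exact: measurable_fejer.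
  exact: mulrl_measurable.
rewrite /fejer_mass /Rintegral -[X in X * _]/(fine t%:E) -fineM//; last first.
  by apply: integrable_fin_num => //; exact: integrable_fejer.
congr fine; rewrite dil muleA -EFinM -ge0_integralZl_EFin//; last 3 first.
- by move=> y _; rewrite lee_fin fejer_ge0.
- exact/measurable_EFinP.
- by rewrite mulr_ge0// ltW.
apply: eq_integral => y _; rewrite -EFinM /fejer mul1r exprMn; congr EFin.
have [->|y0] := eqVneq y 0; first by rewrite mulr0 cos0 subrr !mul0r mulr0.
by field; rewrite y0 gt_eqF.
Qed.

(* [(1 - cos (delta y)) cos (a y)] is the combination
   [- (1 - cos (a y)) + (1 - cos ((a + delta) y)) / 2 + (1 - cos ((a - delta) y)) / 2]. *)
Lemma Rintegral_fejer_cos (delta a b : R) : 0 <= delta ->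
  \int[mu]_y (fejer delta y * cos (a * y + b)) =
  fejer_mass * Num.max 0 (delta - `|a|) * cos b.
Proof.
move=> d0.
have iF t k : mu.-integrable setT (fun y => (k * fejer t y)%:E).
  exact: (integrableZl measurableT k (integrable_fejer t)).
have iS : mu.-integrable setT (fun y => (fejer delta y * sin (a * y))%:E).
  apply: eq_integrable (integrable_fejer_cos delta a (- (pi / 2))) => // y _.
  by rewrite /= cosBpihalf.
transitivity (\int[mu]_y (((cos b / 2 * fejer (a + delta) y +
    cos b / 2 * fejer (a - delta) y) + - cos b * fejer a y)
    + - sin b * (fejer delta y * sin (a * y)))).
  apply: eq_Rintegral => y _.
  rewrite /fejer (_ : (a + delta) * y = a * y + delta * y); last by ring.
  rewrite (_ : (a - delta) * y = a * y - delta * y); last by ring.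
  rewrite cosB !cosD; move: (y ^- 2) => z.
  by field.
have iD := integrableD measurableT (iF (a + delta) (cos b / 2)) (iF (a - delta) (cos b / 2)).
rewrite RintegralD//; last 2 first.
- exact: (integrableD measurableT iD (iF _ _)).
- exact: (integrableZl measurableT (- sin b) iS).
rewrite RintegralD//; last exact: iF.
rewrite RintegralD//; try exact: iF.
rewrite !RintegralZl//; try exact: integrable_fejer.
rewrite !Rintegral_fejer (@Rintegral_odd _ (fun y => fejer delta y * sin (a * y)))//.
  rewrite mulr0 addr0.
  (* The three integrals contribute absolute values, and half the second difference of the absolute
     value with step [delta] is the triangle. The sine part has dropped out by oddness. *)
  have -> : Num.max 0 (delta - `|a|) = (`|a + delta| + `|a - delta|) / 2 - `|a|.
    case: (ger0P a) => ?; case: (ger0P (a + delta)) => ?; case: (ger0P (a - delta)) => ?;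
    by case: leP => ?; lra.
  by ring.
by move=> y; rewrite /fejer !mulrN sinN cosN sqrrN mulrN.
Qed.

#[local] Instance is_derive_affine (p q t : R^o) : is_derive t (1 : R^o) (fun t : R^o => p + q * t) q.
Proof.
apply: is_derive_eq.
by rewrite add0r mul1r; exact: mulr1.
Qed.

#[local] Instance is_derive_sin_affine (w b t : R^o) :
  is_derive t (1 : R^o) (fun t : R^o => sin (b + w * t)) (w * cos (b + w * t)).
Proof.
have := @is_derive1_comp _ (@sin R) (fun t : R^o => b + w * t) t _ _
  (is_derive_sin _) (is_derive_affine b w t).
by rewrite mulrC.
Qed.

#[local] Instance is_derive_cos_affine (w b t : R^o) :
  is_derive t (1 : R^o) (fun t : R^o => cos (b + w * t)) (- w * sin (b + w * t)).
Proof.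
have := @is_derive1_comp _ (@cos R) (fun t : R^o => b + w * t) t _ _
  (is_derive_cos _) (is_derive_affine b w t).
by rewrite mulrC mulNr mulrN.
Qed.

Lemma continuous_affine_cos (p q w b : R) : continuous (fun t : R => (p + q * t) * cos (b + w * t)).
Proof.
move=> t; apply: cvgM.
  by apply: cvgD; [exact: cvg_cst|exact: mulrl_continuous].
apply: continuous_comp; last exact: continuous_cos.
by apply: cvgD; [exact: cvg_cst|exact: mulrl_continuous].
Qed.

Lemma Rintegral_affine_cos (p q w b u v : R) : w != 0 -> u < v ->
  \int[mu]_(t in `[u, v]) ((p + q * t) * cos (b + w * t)) =
  ((p + q * v) * sin (b + w * v) / w + q * cos (b + w * v) / w ^+ 2) -
  ((p + q * u) * sin (b + w * u) / w + q * cos (b + w * u) / w ^+ 2).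
Proof.
move=> w0 uv.
apply: (@Rintegral_FTC _ (fun t => (p + q * t) * sin (b + w * t) / w + q * cos (b + w * t) / w ^+ 2)) => //.
  move=> t.
  apply: is_derive_eq.
  by rewrite /GRing.scale/=; field.
exact: continuous_affine_cos.
Qed.

Lemma Rintegral_affine (p q u v : R) : u < v ->
  \int[mu]_(t in `[u, v]) (p + q * t) =
  (p * v + q / 2 * v ^+ 2) - (p * u + q / 2 * u ^+ 2).
Proof.
move=> uv.
apply: (@Rintegral_FTC _ (fun t => p * t + q / 2 * t ^+ 2)) => //.
  move=> t; apply: is_derive_eq.
  by rewrite /GRing.scale/=; field.
by move=> t; apply: cvgD; [exact: cvg_cst|exact: mulrl_continuous].
Qed.

(* On its support the integrand consists of two pieces, each of which has an
   explicit primitive. *)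
Lemma Rintegral_tri_cos (delta c x b : R) : 0 < delta ->
  \int[mu]_t (Num.max 0 (delta - `|2 * pi * t - c|) * cos (b + 2 * pi * x * t)) =
  (if x == 0 then delta ^+ 2 / (2 * pi) else (1 - cos (delta * x)) / (pi * x ^+ 2))
    * cos (b + x * c).
Proof.
move=> d0; have pi0 : 0 < pi :> R := pi_gt0 R.
have pine : pi != 0 :> R by rewrite gt_eqF.
pose f t := Num.max 0 (delta - `|2 * pi * t - c|) * cos (b + 2 * pi * x * t).
pose l := (c - delta) / (2 * pi); pose m := c / (2 * pi); pose r := (c + delta) / (2 * pi).
have lm : l < m by rewrite ltr_pM2r ?invr_gt0 ?mulr_gt0//; lra.
have mr : m < r by rewrite ltr_pM2r ?invr_gt0 ?mulr_gt0//; lra.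
have pos2 : 0 < 2 * pi :> R by rewrite mulr_gt0.
have lE : 2 * pi * l = c - delta by rewrite /l mulrC divfK ?gt_eqF.
have mE : 2 * pi * m = c by rewrite /m mulrC divfK ?gt_eqF.
have rE : 2 * pi * r = c + delta by rewrite /r mulrC divfK ?gt_eqF.
have cf : continuous f.
  move=> t; apply: cvgM.
    apply: (@continuous_max R R (cst 0) (fun t => delta - `|2 * pi * t - c|) t).
      exact: cvg_cst.
    apply: cvgB; first exact: cvg_cst.
    apply: cvg_norm; apply: cvgB; last exact: cvg_cst.
    exact: mulrl_continuous.
  apply: continuous_comp; last exact: continuous_cos.
  by apply: cvgD; [exact: cvg_cst|exact: mulrl_continuous].
have int_f u v : mu.-integrable `[u, v] (EFin \o f).
  apply: continuous_compact_integrable; first exact: segment_compact.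
  exact: continuous_subspaceT.
transitivity (\int[mu]_(t in `[l, r]) f t).
  rewrite [RHS]Rintegral_mkcond; apply: eq_Rintegral => t _.
  rewrite patchE; case: ifPn => //; rewrite notin_setE/= in_itv/= => tlr.
  rewrite (_ : Num.max _ _ = 0) ?mul0r//.
  apply/max_idPl; rewrite leNgt; apply/negP => tc; apply: tlr.
  move: tc; rewrite subr_gt0 ltr_norml => /andP[? ?].
  by rewrite -(ler_pM2l pos2 l t) -(ler_pM2l pos2 t r) lE rE; apply/andP; split; lra.
have -> : \int[mu]_(t in `[l, r]) f t =
    \int[mu]_(t in `[l, m]) f t + \int[mu]_(t in `[m, r]) f t.
  rewrite -(@Rintegral_itv_obnd_cbnd _ m)//; last first.
    by apply: integrableS (int_f m r) => //; apply: subset_itvr; rewrite bnd_simp.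
  rewrite -(@Rintegral_itvB _ f (BLeft l) (BRight r) m)// ?bnd_simp ?ltW//.
  by rewrite addrC subrK.
have -> : \int[mu]_(t in `[l, m]) f t =
    \int[mu]_(t in `[l, m]) (((delta - c) + 2 * pi * t) * cos (b + 2 * pi * x * t)).
  apply: eq_Rintegral => t; rewrite inE/= in_itv/= -(ler_pM2l pos2 l t) -(ler_pM2l pos2 t m) lE mE => /andP[? ?].
  congr (_ * _); rewrite ler0_norm ?subr_le0//.
  by rewrite (_ : Num.max _ _ = delta - - (2 * pi * t - c)); [ring|apply/max_idPr; lra].
have -> : \int[mu]_(t in `[m, r]) f t =
    \int[mu]_(t in `[m, r]) (((delta + c) + (- (2 * pi)) * t) * cos (b + 2 * pi * x * t)).
  apply: eq_Rintegral => t; rewrite inE/= in_itv/= -(ler_pM2l pos2 m t) -(ler_pM2l pos2 t r) rE mE => /andP[? ?].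
  congr (_ * _); rewrite ger0_norm ?subr_ge0//.
  by rewrite (_ : Num.max _ _ = delta - (2 * pi * t - c)); [ring|apply/max_idPr; lra].
have int_affine p q u v : mu.-integrable `[u, v] (EFin \o (fun t => p + q * t)).
  apply: continuous_compact_integrable; first exact: segment_compact.
  by apply: continuous_subspaceT => t; apply: cvgD; [exact: cvg_cst|exact: mulrl_continuous].
have [->|x0] := eqVneq x 0.
  rewrite mul0r addr0.
  under eq_Rintegral do rewrite mulr0 mul0r addr0.
  under [X in _ + X]eq_Rintegral do rewrite mulr0 mul0r addr0.
  rewrite !RintegralZr//.
  rewrite !Rintegral_affine// /l /m /r.
  by move: (pi : R) pine => P P0; field.
have w0 : 2 * pi * x != 0 by rewrite !mulf_neq0// pnatr_eq0.
rewrite !Rintegral_affine_cos//.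
have wE t : 2 * pi * x * t = x * (2 * pi * t) by ring.
rewrite !wE lE mE rE (mulrC delta x).
rewrite !mulNr mE rE.
rewrite (_ : b + x * (c - delta) = (b + x * c) - x * delta); last by ring.
rewrite (_ : b + x * (c + delta) = (b + x * c) + x * delta); last by ring.
set A := b + x * c; rewrite cosB (cosD A (x * delta)).
by move: (pi : R) pine => P P0; field; rewrite P0 x0.
Qed.

End fejer.

(** * Integration on R^d *)

Section product_integrals.
Context d1 d2 (T1 : measurableType d1) (T2 : measurableType d2) (R : realType).
Variables (m1 : {sigma_finite_measure set T1 -> \bar R})
  (m2 : {sigma_finite_measure set T2 -> \bar R}).

(** Domination by a product of one-variable functions is the hypothesis under which all exchanges of
    integrals below are made; by Tonelli the absolute integral is at most the product of the
    integrals of [|h1|] and [|h2|]. *)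
Lemma dominated_integrable_prod (f : T1 * T2 -> R) (h1 : T1 -> R) (h2 : T2 -> R) :
  measurable_fun setT f ->
  m1.-integrable setT (EFin \o h1) -> m2.-integrable setT (EFin \o h2) ->
  (forall x y, `|f (x, y)| <= h1 x * h2 y) ->
  (m1 \x m2)%E.-integrable setT (EFin \o f).
Proof.
move=> mf i1 i2 fh; apply/integrable12ltyP; first exact/measurable_EFinP.
have mfx x : measurable_fun setT (fun y => f (x, y)).
  by apply: measurableT_comp => //; exact: pair1_measurable.
have mh1 : measurable_fun setT h1 by apply/measurable_EFinP; exact: measurable_int i1.
have mh2 : measurable_fun setT h2 by apply/measurable_EFinP; exact: measurable_int i2.
set J := (\int[m2]_y `|h2 y|%:E)%E.
have J0 : (0 <= J)%E by apply: integral_ge0 => y _; rewrite lee_fin.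
have Jfin : J \is a fin_num.
  by apply: integrable_fin_num => //; exact: integrable_norm.
apply: (@le_lt_trans _ _ (\int[m1]_x (`|h1 x| * fine J)%:E)%E).
  apply: ge0_le_integral => //.
  - by move=> x _; apply: integral_ge0.
  - apply: (measurable_fun_fubini_tonelli_F (fun z => `|(f z)%:E|%E)).
      by apply: measurableT_comp => //; exact/measurable_EFinP.
    by [].
  - by apply/measurable_EFinP/measurable_funM => //; exact: measurableT_comp.
  - move=> x _; rewrite EFinM fineK// -ge0_integralZl//; last by
      apply/measurable_EFinP; exact: measurableT_comp.
    apply: ge0_le_integral => //.
    + by apply: measurableT_comp => //; exact/measurable_EFinP.
    + by apply/measurable_EFinP/measurable_funM => //; exact: measurableT_comp.
    + by move=> y _; rewrite lee_fin (le_trans (fh _ _))// -normrM ler_norm.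
under eq_integral do rewrite EFinM fineK// muleC.
rewrite ge0_integralZl//; last by
  apply/measurable_EFinP; exact: measurableT_comp.
rewrite -(fineK Jfin); apply: lte_mul_pinfty => //.
- by rewrite fineK.
- by apply: integrable_lty => //; exact: integrable_norm.
Qed.

Section dominated.
Context (f : T1 * T2 -> R) (h1 : T1 -> R) (h2 : T2 -> R).
Hypotheses (mf : measurable_fun setT f)
  (i1 : m1.-integrable setT (EFin \o h1)) (i2 : m2.-integrable setT (EFin \o h2))
  (fh : forall x y, `|f (x, y)| <= h1 x * h2 y).

Lemma dominated_integrable1 x : m2.-integrable setT (fun y => (f (x, y))%:E).
Proof.
apply: le_integrable (integrableZl measurableT (h1 x) i2) => //.
  by apply/measurable_EFinP; apply: measurableT_comp => //; exact: pair1_measurable.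
by move=> y _ /=; rewrite lee_fin (le_trans (fh _ _))// ler_norm.
Qed.

Lemma dominated_integrable2 y : m1.-integrable setT (fun x => (f (x, y))%:E).
Proof.
apply: le_integrable (integrableZr measurableT (h2 y) i1) => //.
  by apply/measurable_EFinP; apply: measurableT_comp => //; exact: pair2_measurable.
by move=> x _ /=; rewrite lee_fin (le_trans (fh _ _))// ler_norm.
Qed.

Lemma Rintegral_prod12 :
  fine (\int[(m1 \x m2)%E]_z (f z)%:E) = \int[m1]_x \int[m2]_y f (x, y).
Proof.
have fi := dominated_integrable_prod mf i1 i2 fh.
rewrite -(integral12_prod_meas1 fi); congr fine.
apply: eq_integral => x _; rewrite /Rintegral fineK//.
by apply: integrable_fin_num => //; exact: dominated_integrable1.
Qed.

Lemma Rintegral_prod21 :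
  fine (\int[(m1 \x m2)%E]_z (f z)%:E) = \int[m2]_y \int[m1]_x f (x, y).
Proof.
have fi := dominated_integrable_prod mf i1 i2 fh.
rewrite -(integral21_prod_meas1 fi); congr fine.
apply: eq_integral => x _; rewrite /Rintegral fineK//.
by apply: integrable_fin_num => //; exact: dominated_integrable2.
Qed.

Lemma Rintegral_Fubini :
  \int[m1]_x \int[m2]_y f (x, y) = \int[m2]_y \int[m1]_x f (x, y).
Proof. by rewrite -Rintegral_prod12 Rintegral_prod21. Qed.

End dominated.
End product_integrals.

Lemma integrable_mul_le1 d (T : measurableType d) (R : realType)
    (mu : {measure set T -> \bar R}) (f g : T -> R) :
  mu.-integrable setT (EFin \o f) -> measurable_fun setT g ->
  (forall x, `|g x| <= 1) -> mu.-integrable setT (fun x => (f x * g x)%:E).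
Proof.
move=> fi mg g1; have mf : measurable_fun setT f.
  by apply/measurable_EFinP; exact: measurable_int fi.
apply: (le_integrable measurableT _ _ fi).
  by apply/measurable_EFinP; exact: measurable_funM.
by move=> x _ /=; rewrite lee_fin normrM ler_piMr.
Qed.

Section rV_integrals.
Context {R : realType}.

Lemma mx_norm_le m n (y : 'M[R]_(m, n)) e :
  0 <= e -> (forall i j, `|y i j| <= e) -> `|y| <= e.
Proof.
move=> e0 ye; have [y0|] := eqVneq (mx_norm y) 0.
  by rewrite (mx_norm_eq0 y0) normr0.
by move=> /mx_norm_neq0[[i j]] /= yE; rewrite [leLHS]yE.
Qed.

Lemma measurable_coord d (i : 'I_d) : measurable_fun setT (fun x : 'rV[R]_d => x ord0 i).
Proof. exact: measurable_rV_coord. Qed.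

(** The sigma-algebra is generated by coordinates, so open sets are not measurable by definition.
    Instead [f] is the pointwise limit of its values at grid points of mesh [1 / n.+1], and each
    approximation is constant on each of countably many half-open boxes. *)
Lemma measurable_continuous_rV d (f : 'rV[R]_d -> R) :
  continuous f -> measurable_fun setT f.
Proof.
move=> cf.
pose q n (x : 'rV[R]_d) : 'rV[int]_d := \row_i Num.floor (n.+1%:R * x ord0 i).
pose g n (z : 'rV[int]_d) : 'rV[R]_d := \row_i ((z ord0 i)%:~R / n.+1%:R).
apply: (@measurable_fun_cvg _ _ _ _ (fun n x => f (g n (q n x)))).
  move=> n _ B mB; rewrite setTI.
  rewrite (_ : _ @^-1` _ = \bigcup_(z in setT)
    [set x | q n x = z /\ B (f (g n z))]); last first.
    by apply/seteqP; split=> [x Bx|x [z _] [<-]]//; exists (q n x).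
  apply: countable_bigcupT_measurable => [|z]; first exact: countableP.
  have [Bz|nBz] := pselect (B (f (g n z))); last first.
    by rewrite (_ : [set _ | _] = set0)//; apply/seteqP; split=> x // [].
  rewrite (_ : [set _ | _] = \bigcap_(i in [set: 'I_d])
    ((fun x : 'rV[R]_d => x ord0 i) @^-1`
      `[(z ord0 i)%:~R / n.+1%:R, (z ord0 i + 1)%:~R / n.+1%:R[)).
    apply: fin_bigcap_measurable => // i _.
    by rewrite -[X in measurable X]setTI; exact: measurable_coord.
  have E (x : R) i : (Num.floor (n.+1%:R * x) == z ord0 i) =
      ((z ord0 i)%:~R / n.+1%:R <= x < (z ord0 i + 1)%:~R / n.+1%:R).
    by rewrite floor_eq ler_pdivrMr// ltr_pdivlMr// mulrC.
  apply/seteqP; split => [x [xz _] i _ /=|x xz].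
    by rewrite in_itv/= -E -xz mxE.
  split=> //; apply/rowP => i; rewrite mxE; apply/eqP; rewrite E.
  by have := xz i I; rewrite /= in_itv.
move=> x _; apply: continuous_cvg; first exact: cf.
apply/cvgrPdist_le => e e0; near=> n.
apply: (@le_trans _ _ n.+1%:R^-1); last first.
  by apply: ltW; near: n; exact: (near_infty_natSinv_lt (PosNum e0)).
apply: mx_norm_le => // i j; rewrite !mxE (ord1 i).
have /andP[fl fr] := floor_itv (n.+1%:R * x ord0 j).
have n0 : 0 < n.+1%:R :> R by [].
rewrite -(ler_pM2l n0) mulfV ?gt_eqF// -{1}(gtr0_norm n0) -normrM mulrBr.
rewrite mulrCA mulfV ?gt_eqF// mulr1 ler_norml.
by move: fl fr; rewrite intrD; lra.
Unshelve. all: by end_near. Qed.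

Local Notation leb d := (@lebesgue_rV R d).

Lemma ge0_integral_rVS d (f : 'rV[R]_d.+1 -> \bar R) :
  measurable_fun setT f -> (forall x, 0 <= f x)%E ->
  (\int[leb d.+1]_x f x =
   \int[@lebesgue_measure R]_t \int[leb d]_y f (@rV_cons R d (t, y)))%E.
Proof.
move=> mf f0.
have := @ge0_integral_pushforward _ _ _ _ _ _ (@measurable_rV_cons R d)
  (@lebesgue_measure R \x leb d)%E setT f measurableT mf (fun y _ => f0 y).
rewrite preimage_setT => H.
transitivity (\int[(@lebesgue_measure R \x leb d)%E]_z (f \o @rV_cons R d) z)%E.
  exact: H.
have mfc : measurable_fun setT (f \o @rV_cons R d).
  by apply: measurableT_comp => //; exact: measurable_rV_cons.
exact: (fubini_tonelli1 _ mfc (fun z => f0 _)).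
Qed.

Lemma Rintegral_rVS d (f : 'rV[R]_d.+1 -> R) (h1 : R -> R) (h2 : 'rV[R]_d -> R) :
  measurable_fun setT f ->
  (@lebesgue_measure R).-integrable setT (EFin \o h1) ->
  (leb d).-integrable setT (EFin \o h2) ->
  (forall t y, `|f (@rV_cons R d (t, y))| <= h1 t * h2 y) ->
  \int[leb d.+1]_x f x =
  \int[@lebesgue_measure R]_t \int[leb d]_y f (@rV_cons R d (t, y)).
Proof.
move=> mf i1 i2 fh.
have mfc : measurable_fun setT (f \o @rV_cons R d).
  by apply: measurableT_comp => //; exact: measurable_rV_cons.
rewrite -(@Rintegral_prod12 _ _ _ _ _ _ _ (f \o @rV_cons R d) h1 h2)//.
congr fine.
have := @integral_pushforward _ _ _ _ _ _ (@measurable_rV_cons R d)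
  (@lebesgue_measure R \x leb d)%E setT (EFin \o f).
rewrite preimage_setT; apply => //; first exact/measurable_EFinP.
exact: (dominated_integrable_prod mfc i1 i2).
Qed.

Definition tensor d (v : 'I_d -> R -> R) (x : 'rV[R]_d) : R :=
  \prod_(i < d) v i (x ord0 i).

Lemma rV_cons0 d (z : measurableTypeR R * 'rV[R]_d) : @rV_cons R d z ord0 ord0 = z.1.
Proof.
transitivity (row_mx (\row__ (z.1 : R)) z.2 ord0 (lshift d (ord0 : 'I_1))).
  by congr (row_mx _ _ _ _); exact/val_inj.
by rewrite row_mxEl mxE.
Qed.

Lemma rV_consS d (z : measurableTypeR R * 'rV[R]_d) i :
  @rV_cons R d z ord0 (lift ord0 i) = z.2 ord0 i.
Proof.
transitivity (row_mx (\row__ (z.1 : R)) z.2 ord0 (rshift 1 i)); last by rewrite row_mxEr.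
by congr (row_mx _ _ _ _); rewrite rshift1.
Qed.

Lemma tensor_cons d (v : 'I_d.+1 -> R -> R) t y :
  tensor v (@rV_cons R d (t, y)) = v ord0 t * tensor (fun i => v (lift ord0 i)) y.
Proof.
rewrite /tensor big_ord_recl rV_cons0; congr (_ * _).
by apply: eq_bigr => i _; rewrite rV_consS.
Qed.

Lemma measurable_tensor d (v : 'I_d -> R -> R) :
  (forall i, measurable_fun setT (v i)) -> measurable_fun setT (tensor v).
Proof.
move=> mv; apply: measurable_prod => i _.
by apply: measurableT_comp => //; exact: measurable_coord.
Qed.

Lemma integrable_tensor d (v : 'I_d -> R -> R) :
  (forall i, (@lebesgue_measure R).-integrable setT (EFin \o v i)) ->
  (leb d).-integrable setT (EFin \o tensor v).
Proof.
elim: d v => [|d ih] v vi.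
  have : (leb 0).-integrable setT (EFin \o cst (1 : R)).
    by apply: finite_measure_integrable_cst.
  by apply: eq_integrable => // x _ /=; rewrite /tensor big_ord0.
have mv i : measurable_fun setT (v i) by apply/measurable_EFinP; exact: measurable_int (vi i).
apply/integrableP; split; first by apply/measurable_EFinP; exact: measurable_tensor.
rewrite ge0_integral_rVS//; last first.
  by apply: measurableT_comp => //; apply/measurable_EFinP; exact: measurable_tensor.
have H : (@lebesgue_measure R \x leb d)%E.-integrable setT (EFin \o (tensor v \o @rV_cons R d)).
  apply: (dominated_integrable_prod _ (integrable_norm (vi ord0))
    (integrable_norm (ih _ (fun i => vi (lift ord0 i))))).
    by apply: measurableT_comp; [exact: measurable_tensor|exact: measurable_rV_cons].
  by move=> t y /=; rewrite tensor_cons normrM.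
exact: ((integrable12ltyP _ _ (measurable_int _ H)).1 H).
Qed.

Lemma measurable_linear_form d (a : 'I_d -> R) :
  measurable_fun setT (fun x : 'rV[R]_d => \sum_i a i * x ord0 i).
Proof.
apply: measurable_sum => i; apply: measurable_funM => //.
exact: measurable_coord.
Qed.

(* The free phase [b] absorbs the remaining coordinates in the induction on the
   dimension, and with [b - pi / 2] it also yields the sine integral. *)
Lemma Rintegral_tensor_cos d (v : 'I_d -> R -> R) (a K theta : 'I_d -> R) (b : R) :
  (forall i, (@lebesgue_measure R).-integrable setT (EFin \o v i)) ->
  (forall i b, \int[@lebesgue_measure R]_t (v i t * cos (b + a i * t)) =
    K i * cos (b + theta i)) ->
  \int[leb d]_x (tensor v x * cos (b + \sum_i a i * x ord0 i)) =
  (\prod_i K i) * cos (b + \sum_i theta i).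
Proof.
elim: d v a K theta b => [|d ih] v a K theta b vi vK.
  rewrite big_ord0 [in RHS]big_ord0 addr0 mul1r /Rintegral integral_dirac//.
    by rewrite diracT mul1e /= /tensor !big_ord0 mul1r addr0.
  apply/measurable_EFinP; apply: measurable_funM; last first.
    apply: measurableT_comp; first by apply: continuous_measurable_fun; exact: continuous_cos.
    by apply: measurable_funD => //; exact: measurable_linear_form.
  by apply: measurable_tensor => -[].
have mv i : measurable_fun setT (v i) by apply/measurable_EFinP; exact: measurable_int (vi i).
rewrite (@Rintegral_rVS _ _ (fun t => `|v ord0 t|) (fun y => `|tensor (fun i => v (lift ord0 i)) y|)).
- transitivity (\int[@lebesgue_measure R]_t
    (\prod_i K (lift ord0 i) * (v ord0 t * cos (b + \sum_i theta (lift ord0 i) + a ord0 * t)))).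
    apply: eq_Rintegral => t _.
    under eq_Rintegral => y _.
      rewrite tensor_cons -mulrA.
      rewrite big_ord_recl rV_cons0 addrA /=.
      under eq_bigr do rewrite rV_consS /=.
      over.
    rewrite RintegralZl//; last first.
      apply: integrable_mul_le1; first exact: integrable_tensor.
        apply: measurableT_comp; first by apply: continuous_measurable_fun; exact: continuous_cos.
        by apply: measurable_funD => //; exact: measurable_linear_form.
      by move=> y; exact: cos_max.
    rewrite (ih _ _ (fun i => K (lift ord0 i)) (fun i => theta (lift ord0 i)))//.
    by rewrite mulrCA addrAC.
  rewrite RintegralZl//; last first.
    apply: integrable_mul_le1 => // [|t]; last exact: cos_max.
    apply: measurableT_comp; first by apply: continuous_measurable_fun; exact: continuous_cos.
    by apply: measurable_funD => //; exact: mulrl_measurable.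
  rewrite vK big_ord_recl [in RHS]big_ord_recl.
  by rewrite mulrA (mulrC (K ord0)) -addrA (addrC (theta _)).
- apply: measurable_funM; first exact: measurable_tensor.
  apply: measurableT_comp; first by apply: continuous_measurable_fun; exact: continuous_cos.
  by apply: measurable_funD => //; exact: measurable_linear_form.
- exact: integrable_norm.
- by apply: integrable_norm; apply: integrable_tensor => i.
- by move=> t y; rewrite tensor_cons 2!normrM ler_piMr// cos_max.
Qed.

End rV_integrals.

(** * Complex-valued integrals *)

Section complex_numbers.
Context {R : realType}.
Implicit Types z w : R[i].

Lemma creD z w : cre (z + w) = cre z + cre w. Proof. by case: z; case: w. Qed.
Lemma cimD z w : cim (z + w) = cim z + cim w. Proof. by case: z; case: w. Qed.
Lemma creM z w : cre (z * w) = cre z * cre w - cim z * cim w.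
Proof. by case: z; case: w. Qed.
Lemma cimM z w : cim (z * w) = cre z * cim w + cim z * cre w.
Proof. by case: z; case: w. Qed.

Lemma complexP z w : cre z = cre w -> cim z = cim w -> z = w.
Proof. by case: z w => [a b] [c d] /= -> ->. Qed.

Lemma normc_ge0 z : 0 <= normc z.
Proof. by case: z => a b; exact: sqrtr_ge0. Qed.

Lemma normr_cre_le z : `|cre z| <= normc z.
Proof.
case: z => a b /=; rewrite -[leLHS]sqrtr_sqr ler_wsqrtr// lerDl sqr_ge0//.
Qed.

Lemma normr_cim_le z : `|cim z| <= normc z.
Proof.
case: z => a b /=; rewrite -[leLHS]sqrtr_sqr ler_wsqrtr// lerDr sqr_ge0//.
Qed.

Lemma normc_le_reim z : normc z <= `|cre z| + `|cim z|.
Proof.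
case: z => a b /=; rewrite -[leRHS]ger0_norm ?addr_ge0// -sqrtr_sqr ler_wsqrtr//.
by rewrite sqrrD !real_normK ?num_real// addrAC lerDl mulrn_wge0// mulr_ge0.
Qed.

Lemma normc_real (x : R) : normc x%:C = `|x|.
Proof. by rewrite /= expr0n/= addr0 sqrtr_sqr. Qed.

Lemma normc_cexpi (t : R) : normc (cexpi t) = 1.
Proof. by rewrite /= cos2Dsin2 sqrtr1. Qed.

Lemma cexpiD (s t : R) : cexpi (s + t) = cexpi s * cexpi t.
Proof.
apply: complexP; first by rewrite creM /= cosD.
by rewrite cimM /= sinD addrC.
Qed.

Lemma cexpi0 : cexpi (0 : R) = 1.
Proof. by rewrite /cexpi cos0 sin0. Qed.

End complex_numbers.

Section complex_measurable.
Context {R : realType} d (T : measurableType d).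
Implicit Types f g : T -> R[i].

Definition cmeasurable f :=
  measurable_fun setT (cre \o f) /\ measurable_fun setT (cim \o f).

Lemma cmeasurable_cst (c : R[i]) : cmeasurable (fun=> c).
Proof. by split; exact: measurable_cst. Qed.

Lemma cmeasurableD f g : cmeasurable f -> cmeasurable g -> cmeasurable (fun x => f x + g x).
Proof.
move=> [fr fi] [gr gi]; split; rewrite /comp.
  by under eq_fun do rewrite creD; exact: measurable_funD.
by under eq_fun do rewrite cimD; exact: measurable_funD.
Qed.

Lemma cmeasurableM f g : cmeasurable f -> cmeasurable g -> cmeasurable (fun x => f x * g x).
Proof.
move=> [fr fi] [gr gi]; split; rewrite /comp.
  by under eq_fun do rewrite creM; apply: measurable_funB; exact: measurable_funM.
by under eq_fun do rewrite cimM; apply: measurable_funD; exact: measurable_funM.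
Qed.

Lemma cmeasurable_real (u : T -> R) : measurable_fun setT u -> cmeasurable (fun x => (u x)%:C).
Proof. by move=> mu; split => //; exact: measurable_cst. Qed.

Lemma cmeasurable_cexpi (u : T -> R) : measurable_fun setT u -> cmeasurable (fun x => cexpi (u x)).
Proof.
move=> mu; split.
  apply: (measurableT_comp (f := @cos R)) => //.
  by apply: continuous_measurable_fun; exact: continuous_cos.
apply: (measurableT_comp (f := @sin R)) => //.
by apply: continuous_measurable_fun; exact: continuous_sin.
Qed.

End complex_measurable.

Lemma cmeasurable_comp {R : realType} d1 d2 (T1 : measurableType d1) (T2 : measurableType d2)
    (f : T2 -> R[i]) (g : T1 -> T2) :
  cmeasurable f -> measurable_fun setT g -> cmeasurable (f \o g).
Proof. by move=> [fr fi] mg; split; [exact: (measurableT_comp fr)|exact: (measurableT_comp fi)]. Qed.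

Section complex_integral.
Context {R : realType} d (T : measurableType d) (mu : {measure set T -> \bar R}).
Implicit Types (f g : T -> R[i]) (h : T -> R).

Definition cintegrable f :=
  mu.-integrable setT (EFin \o (cre \o f)) /\ mu.-integrable setT (EFin \o (cim \o f)).

Definition cint f : R[i] := (\int[mu]_x cre (f x)) +i* (\int[mu]_x cim (f x)).

Lemma cintegrable_dominated f h : cmeasurable f -> mu.-integrable setT (EFin \o h) ->
  (forall x, normc (f x) <= h x) -> cintegrable f.
Proof.
move=> [fr fi] ih fh; split; apply: (le_integrable measurableT _ _ ih).
- exact/measurable_EFinP.
- move=> x _ /=; rewrite lee_fin (le_trans (normr_cre_le _))//.
  by rewrite (le_trans (fh _))// ler_norm.
- exact/measurable_EFinP.
- move=> x _ /=; rewrite lee_fin (le_trans (normr_cim_le _))//.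
  by rewrite (le_trans (fh _))// ler_norm.
Qed.

Lemma eq_cint f g : f =1 g -> cint f = cint g.
Proof. by move=> /funext ->. Qed.

Lemma cintD f g : cintegrable f -> cintegrable g ->
  cint (fun x => f x + g x) = cint f + cint g.
Proof.
move=> [fr fi] [gr gi]; apply: complexP => /=.
  by under eq_Rintegral do rewrite creD; rewrite RintegralD.
by under eq_Rintegral do rewrite cimD; rewrite RintegralD.
Qed.

Lemma cintZ (c : R[i]) f : cintegrable f -> cint (fun x => c * f x) = c * cint f.
Proof.
have iZ k h : mu.-integrable setT (EFin \o h) -> mu.-integrable setT (EFin \o (fun x => k * h x)).
  by move=> ih; apply: eq_integrable (integrableZl measurableT k ih).
move=> [fr fi]; apply: complexP.
  rewrite creM /=; under eq_Rintegral do rewrite creM.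
  by rewrite RintegralB ?RintegralZl//; exact: iZ.
rewrite cimM /=; under eq_Rintegral do rewrite cimM.
by rewrite RintegralD ?RintegralZl//; exact: iZ.
Qed.

(** The factor 2 comes from estimating the real and the imaginary part separately. *)
Lemma normc_cint_le f h : cmeasurable f -> mu.-integrable setT (EFin \o h) ->
  (forall x, normc (f x) <= h x) -> normc (cint f) <= 2 * \int[mu]_x h x.
Proof.
move=> mf ih fh; have [fr fi] := cintegrable_dominated mf ih fh.
rewrite (le_trans (normc_le_reim _))//= mulrDl mul1r lerD//.
  apply: le_trans (le_normr_Rintegral measurableT fr) _.
  apply: le_Rintegral => //; first exact: integrable_norm.
  by move=> x _; exact: le_trans (normr_cre_le _) (fh _).
apply: le_trans (le_normr_Rintegral measurableT fi) _.
apply: le_Rintegral => //; first exact: integrable_norm.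
by move=> x _; exact: le_trans (normr_cim_le _) (fh _).
Qed.

End complex_integral.

Lemma cint_Fubini {R : realType} d1 d2 (T1 : measurableType d1) (T2 : measurableType d2)
    (m1 : {sigma_finite_measure set T1 -> \bar R})
    (m2 : {sigma_finite_measure set T2 -> \bar R})
    (f : T1 * T2 -> R[i]) (h1 : T1 -> R) (h2 : T2 -> R) :
  cmeasurable f -> m1.-integrable setT (EFin \o h1) -> m2.-integrable setT (EFin \o h2) ->
  (forall x y, normc (f (x, y)) <= h1 x * h2 y) ->
  cint m1 (fun x => cint m2 (fun y => f (x, y))) =
  cint m2 (fun y => cint m1 (fun x => f (x, y))).
Proof.
move=> [fr fi] i1 i2 fh; apply: complexP => /=.
  apply: (Rintegral_Fubini (f := cre \o f) _ i1 i2) => // x y.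
  exact: le_trans (normr_cre_le _) (fh _ _).
apply: (Rintegral_Fubini (f := cim \o f) _ i1 i2) => // x y.
exact: le_trans (normr_cim_le _) (fh _ _).
Qed.

(** * Wave packets against Fourier transforms *)

Lemma cintegrable_cint {R : realType} d1 d2 (T1 : measurableType d1) (T2 : measurableType d2)
    (m1 : {sigma_finite_measure set T1 -> \bar R})
    (m2 : {sigma_finite_measure set T2 -> \bar R})
    (f : T1 * T2 -> R[i]) (h1 : T1 -> R) (h2 : T2 -> R) :
  cmeasurable f -> m1.-integrable setT (EFin \o h1) -> m2.-integrable setT (EFin \o h2) ->
  (forall x y, normc (f (x, y)) <= h1 x * h2 y) ->
  cintegrable m1 (fun x => cint m2 (fun y => f (x, y))).
Proof.
move=> [fr fi] i1 i2 fh.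
have H (u : T1 * T2 -> R) : measurable_fun setT u ->
    (forall x y, `|u (x, y)| <= h1 x * h2 y) ->
    m1.-integrable setT (EFin \o (fun x => \int[m2]_y u (x, y))).
  move=> mu uh.
  have /integrable_fubini_F := dominated_integrable_prod mu i1 i2 uh.
  apply: eq_integrable => // x _; rewrite /fubini_F /= /Rintegral fineK//.
  by apply: integrable_fin_num => //; exact: (dominated_integrable1 mu i2 uh).
split.
- apply: (H (cre \o f)) => // x y; exact: le_trans (normr_cre_le _) (fh _ _).
- apply: (H (cim \o f)) => // x y; exact: le_trans (normr_cim_le _) (fh _ _).
Qed.

Section kernel.
Context {R : realType}.
Variable d : nat.
Local Notation mu := (@lebesgue_measure R).
Local Notation leb := (@lebesgue_rV R d).
Implicit Types (x y xi omega : 'rV[R]_d) (delta : R).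

Lemma cint_tensor_cexpi (v : 'I_d -> R -> R) (a K theta : 'I_d -> R) :
  (forall i, mu.-integrable setT (EFin \o v i)) ->
  (forall i b, \int[mu]_t (v i t * cos (b + a i * t)) = K i * cos (b + theta i)) ->
  cint leb (fun x => (tensor v x)%:C * cexpi (\sum_i a i * x ord0 i)) =
  (\prod_i K i)%:C * cexpi (\sum_i theta i).
Proof.
move=> vi vK; apply: complexP; rewrite ?creM ?cimM /= ?mul0r ?subr0 ?addr0.
  rewrite -[X in cos X]add0r -(Rintegral_tensor_cos 0 vi vK).
  by apply: eq_Rintegral => x _; rewrite mul0r subr0 add0r.
rewrite -cosBpihalf addrC -(Rintegral_tensor_cos (- (pi / 2)) vi vK).
by apply: eq_Rintegral => x _; rewrite mul0r addr0 -cosBpihalf addrC.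
Qed.

Lemma measurable_dotp1 (x : 'rV[R]_d) : measurable_fun setT (dotp x).
Proof. exact: measurable_linear_form. Qed.

Lemma dotpC x y : dotp x y = dotp y x.
Proof. by apply: eq_bigr => i _; rewrite mulrC. Qed.

Lemma measurable_dotp : measurable_fun setT (fun z : 'rV[R]_d * 'rV[R]_d => dotp z.1 z.2).
Proof.
apply: measurable_sum => i; apply: measurable_funM.
  by apply: (measurableT_comp (measurable_coord i)); exact: measurable_fst.
by apply: (measurableT_comp (measurable_coord i)); exact: measurable_snd.
Qed.

(** The Fourier transform at [t] of [fejer delta] modulated to frequency [w]; it vanishes at
    distance [delta / (2 * pi)] or more from [w]. *)
Definition tri delta (w t : R) : R := fejer_mass * Num.max 0 (delta - `|2 * pi * t - 2 * pi * w|).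

(** The inverse Fourier transform of [tri delta 0], computed directly. Since [fejer_mass] is pi,
    this is [fejer delta] with its value at 0 corrected to the limit. *)
Definition kern delta (t : R) : R := fejer_mass *
  (if t == 0 then delta ^+ 2 / (2 * pi) else (1 - cos (delta * t)) / (pi * t ^+ 2)).

Definition fejer_rV delta : 'rV[R]_d -> R := tensor (fun=> fejer delta).
Definition kern_rV delta : 'rV[R]_d -> R := tensor (fun=> kern delta).
Definition tri_rV delta omega : 'rV[R]_d -> R := tensor (fun i => tri delta (omega ord0 i)).

Lemma integrable_fejer_rV delta : leb.-integrable setT (EFin \o fejer_rV delta).
Proof. by apply: integrable_tensor => i; exact: integrable_fejer. Qed.

Lemma fejer_rV_ge0 delta y : 0 <= fejer_rV delta y.
Proof. by apply: prodr_ge0 => i _; exact: fejer_ge0. Qed.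

Lemma measurable_fejer_rV delta : measurable_fun setT (fejer_rV delta).
Proof. by apply: measurable_tensor => i; exact: measurable_fejer. Qed.

Lemma cint_fejer_rV delta omega xi : 0 <= delta ->
  cint leb (fun y => (fejer_rV delta y)%:C * cexpi (2 * pi * dotp y (omega - xi))) =
  (tri_rV delta omega xi)%:C.
Proof.
move=> d0.
have H := @cint_tensor_cexpi (fun=> fejer delta)
  (fun i => 2 * pi * (omega ord0 i - xi ord0 i))
  (fun i => tri delta (omega ord0 i) (xi ord0 i)) (fun=> 0).
rewrite big1_eq cexpi0 mulr1 in H; rewrite -H.
- apply: eq_cint => y; congr (_ * cexpi _); rewrite /dotp mulr_sumr.
  by apply: eq_bigr => i _; rewrite !mxE; ring.
- by move=> i; exact: integrable_fejer.
- move=> i b; rewrite addr0 /tri -[X in `|X|]opprB normrN -mulrBr -Rintegral_fejer_cos//.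
  by apply: eq_Rintegral => t _; rewrite addrC.
Qed.

Lemma integrable_tri delta w : 0 < delta -> mu.-integrable setT (EFin \o tri delta w).
Proof.
move=> d0; pose l := w - delta / (2 * pi); pose r := w + delta / (2 * pi).
have pi0 : 0 < 2 * pi :> R by rewrite mulr_gt0 ?pi_gt0.
have ind : mu.-integrable setT (EFin \o \1_`[l, r]).
  exact: (@integrable_indic_itv _ l r true false).
apply: (le_integrable measurableT _ _ (integrableZl measurableT (fejer_mass * delta) ind)).
  apply/measurable_EFinP; apply: measurable_funM => //.
  apply: measurable_maxr => //; apply: measurable_funB => //.
  apply: measurableT_comp => //; apply: measurable_funB => //.
move=> t _ /=; rewrite lee_fin /tri -(mulrA fejer_mass delta) 2!(normrM fejer_mass) ler_wpM2l//.
rewrite indicE; case: (boolP (t \in _)) => [_|].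
  rewrite mulr1 ger0_norm ?le_max ?lexx// gtr0_norm// ge_max ltW//=.
  by rewrite lerBlDr lerDl.
rewrite notin_setE/= in_itv/= => tlr.
rewrite (_ : Num.max _ _ = 0) ?normr0 ?mulr_ge0//.
apply/max_idPl; rewrite leNgt; apply/negP => tc; apply: tlr.
move: tc; rewrite subr_gt0 ltr_norml -mulrBr => /andP[].
rewrite mulrC -ltr_pdivrMr// mulNr => tl; rewrite -ltr_pdivlMr// => tr.
by rewrite /l /r; apply/andP; split; lra.
Qed.

Lemma cint_tri_rV delta omega x : 0 < delta ->
  cint leb (fun xi => (tri_rV delta omega xi)%:C * cexpi (2 * pi * dotp x xi)) =
  (kern_rV delta x)%:C * cexpi (2 * pi * dotp x omega).
Proof.
move=> d0.
have dE xi : 2 * pi * dotp x xi = \sum_i 2 * pi * x ord0 i * xi ord0 i.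
  by rewrite /dotp mulr_sumr; apply: eq_bigr => i _; rewrite mulrA.
rewrite [in RHS]dE.
rewrite -(@cint_tensor_cexpi (fun i => tri delta (omega ord0 i))
  (fun i => 2 * pi * x ord0 i) (fun i => kern delta (x ord0 i))
  (fun i => 2 * pi * x ord0 i * omega ord0 i)).
- by apply: eq_cint => xi; rewrite dE.
- by move=> i; exact: integrable_tri.
- move=> i b.
  rewrite /kern (_ : 2 * pi * x ord0 i * omega ord0 i = x ord0 i * (2 * pi * omega ord0 i)); last by ring.
  rewrite -(mulrA fejer_mass) -(Rintegral_tri_cos (2 * pi * omega ord0 i) (x ord0 i) b d0).
  rewrite -RintegralZl//.
    by apply: eq_Rintegral => t _; rewrite /tri mulrA.
  have M0 : fejer_mass != 0 :> R by rewrite gt_eqF// fejer_mass_gt0.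
  apply: integrable_mul_le1.
  - apply: eq_integrable (integrableZl measurableT fejer_mass^-1
      (integrable_tri (omega ord0 i) d0)) => // t _.
    by rewrite /= -EFinM /tri mulKf.
  - have := measurable_cos_affine (2 * pi * x ord0 i) b.
    by under eq_fun do rewrite addrC.
  - by move=> t; exact: cos_max.
Qed.

Lemma fourier_cint (h : 'rV[R]_d -> R[i]) y :
  fourier h y = cint leb (fun xi => h xi * cexpi (- (2 * pi * dotp xi y))).
Proof. by []. Qed.

Lemma dotpD x y xi : dotp xi (x + y) = dotp xi x + dotp xi y.
Proof. by rewrite /dotp -big_split; apply: eq_bigr => i _; rewrite mxE mulrDr. Qed.

Lemma dotpN y xi : dotp xi (- y) = - dotp xi y.
Proof. by rewrite /dotp -sumrN; apply: eq_bigr => i _; rewrite mxE mulrN. Qed.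

Lemma dotpZ (a : R) y xi : dotp xi (a *: y) = a * dotp xi y.
Proof. by rewrite /dotp mulr_sumr; apply: eq_bigr => i _; rewrite mxE mulrCA. Qed.

Definition wave_packet delta omega y : R[i] :=
  (fejer_rV delta y)%:C * cexpi (2 * pi * dotp y omega).

Lemma cmeasurable_wave_packet delta omega : cmeasurable (wave_packet delta omega).
Proof.
apply: cmeasurableM.
  by apply: cmeasurable_real; exact: measurable_fejer_rV.
apply: cmeasurable_cexpi; apply: measurable_funM => //.
by under eq_fun do rewrite dotpC; exact: measurable_dotp1.
Qed.

Lemma normc_wave_packet delta omega y : normc (wave_packet delta omega y) = fejer_rV delta y.
Proof. by rewrite normcM normc_cexpi mulr1 normc_real ger0_norm// fejer_rV_ge0. Qed.

Section pairing.
Variables (h : 'rV[R]_d -> R[i]) (H : 'rV[R]_d -> R) (delta : R) (omega : 'rV[R]_d).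
Hypotheses (mh : cmeasurable h) (iH : leb.-integrable setT (EFin \o H))
  (hH : forall xi, normc (h xi) <= H xi).

Let F (z : 'rV[R]_d * 'rV[R]_d) : R[i] :=
  wave_packet delta omega z.1 * (h z.2 * cexpi (- (2 * pi * dotp z.2 z.1))).

Let mF : cmeasurable F.
Proof.
apply: cmeasurableM.
  by apply: (cmeasurable_comp (cmeasurable_wave_packet _ _)); exact: measurable_fst.
apply: cmeasurableM; first by apply: (cmeasurable_comp mh); exact: measurable_snd.
apply: cmeasurable_cexpi; apply: measurableT_comp => //; apply: measurable_funM => //.
by under eq_fun do rewrite dotpC; exact: measurable_dotp.
Qed.

Let F_le y xi : normc (F (y, xi)) <= fejer_rV delta y * H xi.
Proof.
rewrite normcM normc_wave_packet normcM normc_cexpi mulr1.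
by rewrite ler_wpM2l// fejer_rV_ge0.
Qed.

Let ch y : cintegrable leb (fun xi => h xi * cexpi (- (2 * pi * dotp xi y))).
Proof.
apply: (cintegrable_dominated _ iH); last first.
  by move=> xi; rewrite normcM normc_cexpi mulr1.
apply: cmeasurableM => //; apply: cmeasurable_cexpi.
apply: measurableT_comp => //; apply: measurable_funM => //.
by under eq_fun do rewrite dotpC; exact: measurable_dotp1.
Qed.

Lemma cintegrable_wave_packet_fourier :
  cintegrable leb (fun y => wave_packet delta omega y * fourier h y).
Proof.
have := cintegrable_cint mF (integrable_fejer_rV delta) iH F_le.
rewrite (_ : (fun y => cint leb _) = (fun y => wave_packet delta omega y * fourier h y))//.
by apply/funext => y; rewrite fourier_cint /F /= cintZ.
Qed.

(* Exchanging the two integrations transfers the Fourier transform from [h] to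
   the wave packet, whose own transform is the explicit triangle [tri_rV]. *)
Lemma pairing_fourier x (c : R[i]) : 0 < delta ->
  (forall xi, tri_rV delta omega xi != 0 -> h xi = c * cexpi (2 * pi * dotp x xi)) ->
  cint leb (fun y => wave_packet delta omega y * fourier h y) =
  c * ((kern_rV delta x)%:C * cexpi (2 * pi * dotp x omega)).
Proof.
move=> d0 hc.
transitivity (cint leb (fun y => cint leb (fun xi => F (y, xi)))).
  by apply: eq_cint => y; rewrite fourier_cint /F /= cintZ.
rewrite (cint_Fubini mF (integrable_fejer_rV delta) iH F_le).
rewrite -cint_tri_rV// -cintZ; last first.
  apply: (@cintegrable_dominated _ _ _ _ _ (tri_rV delta omega)).
  - apply: cmeasurableM; last first.
      apply: cmeasurable_cexpi; apply: measurable_funM => //; exact: measurable_dotp1.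
    apply: cmeasurable_real; apply/measurable_EFinP.
    by apply: measurable_int; apply: integrable_tensor => i; exact: integrable_tri.
  - by apply: integrable_tensor => i; exact: integrable_tri.
  - move=> xi; rewrite normcM normc_cexpi mulr1 normc_real ger0_norm//.
    apply: prodr_ge0 => i _; rewrite /tri mulr_ge0 ?le_max ?lexx//.
    by rewrite ltW// fejer_mass_gt0.
apply: eq_cint => xi.
transitivity (h xi * cint leb (fun y => (fejer_rV delta y)%:C * cexpi (2 * pi * dotp y (omega - xi)))).
  rewrite -cintZ.
    apply: eq_cint => y; rewrite /F /wave_packet /= mulrCA -!mulrA -cexpiD.
    by congr (_ * (_ * cexpi _)); rewrite dotpD dotpN (dotpC xi); ring.
  apply: (@cintegrable_dominated _ _ _ _ _ (fejer_rV delta)).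
  - apply: cmeasurableM; first by apply: cmeasurable_real; exact: measurable_fejer_rV.
    apply: cmeasurable_cexpi; apply: measurable_funM => //.
    by under eq_fun do rewrite dotpC; exact: measurable_dotp1.
  - exact: integrable_fejer_rV.
  - by move=> y; rewrite normcM normc_cexpi mulr1 normc_real ger0_norm// fejer_rV_ge0.
rewrite cint_fejer_rV ?ltW//.
(* Off the support of the triangle both sides vanish, so [h] matters only where [hc] prescribes
   it. *)
have [->|t0] := eqVneq (tri_rV delta omega xi) 0; first by rewrite mul0r !mulr0.
by rewrite hc// -mulrA; congr (_ * _); rewrite mulrC.
Qed.

End pairing.
End kernel.

(** * Complex series and finite differences *)

Section complex_series.
Context {R : realType}.
Implicit Types u v : nat -> R[i].

Definition csum u : R[i] :=
  (limn (series (fun n => cre (u n)))) +i* (limn (series (fun n => cim (u n)))).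

Lemma geometric_dominated (a : nat -> R) C : (forall n, `|a n| <= C / 2 ^+ n) ->
  cvgn (series a) /\ `|limn (series a)| <= 2 * C.
Proof.
move=> aC.
have gE n : C / 2 ^+ n = geometric C 2^-1 n by rewrite /= exprVn.
have half : `|2^-1 : R| < 1 by rewrite ger0_norm; lra.
have na : cvgn [normed series a].
  apply: (@series_le_cvg _ _ (geometric C 2^-1)) => [n|n|n|].
  - exact: normr_ge0.
  - by rewrite -gE; apply: le_trans (aC n).
  - by rewrite -gE; exact: aC.
  - exact: is_cvg_geometric_series.
have ca := normed_cvg na; split=> //.
apply: le_trans (lim_series_norm na) _.
have -> : 2 * C = limn (series (geometric C 2^-1)).
  by rewrite (cvg_lim _ (cvg_geometric_series half))//; field.
apply: lim_series_le => //; first exact: is_cvg_geometric_series.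
by move=> n; rewrite -gE; exact: aC.
Qed.

(** The limit of a divergent series is a default value, so linearity rests on the geometric bounds,
    which make all component series converge. *)
Lemma csum_linear (a : R[i]) u v C D :
  (forall n, normc (u n) <= C / 2 ^+ n) -> (forall n, normc (v n) <= D / 2 ^+ n) ->
  csum (fun n => a * u n + v n) = a * csum u + csum v.
Proof.
move=> uC vD.
have [cur _] := geometric_dominated (fun n => le_trans (normr_cre_le _) (uC n)).
have [cui _] := geometric_dominated (fun n => le_trans (normr_cim_le _) (uC n)).
have [cvr _] := geometric_dominated (fun n => le_trans (normr_cre_le _) (vD n)).
have [cvi _] := geometric_dominated (fun n => le_trans (normr_cim_le _) (vD n)).
have sZ (k : R) (w : nat -> R) : cvgn (series w) -> series (fun n => k * w n) @ \oo --> k * limn (series w).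
  move=> cw; rewrite (_ : series _ = (fun n => k * series w n)).
    by apply: cvgM => //; exact: cvg_cst.
  by apply/funext => n; rewrite /series/= mulr_sumr.
have sD (w1 w2 : nat -> R) (l1 l2 : R) : series w1 @ \oo --> l1 -> series w2 @ \oo --> l2 ->
    series (fun n => w1 n + w2 n) @ \oo --> l1 + l2.
  move=> c1 c2; rewrite (_ : series _ = (fun n => series w1 n + series w2 n)).
    exact: cvgD.
  by apply/funext => n; rewrite /series/= big_split.
apply: complexP; rewrite ?creD ?cimD ?creM ?cimM /=; apply: cvg_lim => //.
- rewrite (_ : (fun n => _) = (fun n => (cre a * cre (u n) + - cim a * cim (u n)) + cre (v n))).
    by rewrite -mulNr; apply: (sD _ _ _ _ _ _) => //; apply: (sD _ _ _ _ _ _); exact: sZ.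
  by apply/funext => n; rewrite creD creM mulNr.
- rewrite (_ : (fun n => _) = (fun n => (cre a * cim (u n) + cim a * cre (u n)) + cim (v n))).
    by apply: (sD _ _ _ _ _ _) => //; apply: (sD _ _ _ _ _ _); exact: sZ.
  by apply/funext => n; rewrite cimD cimM.
Qed.

Lemma normc_csum u C : (forall n, normc (u n) <= C / 2 ^+ n) -> normc (csum u) <= 4 * C.
Proof.
move=> uC; apply: le_trans (normc_le_reim _) _.
have [_ ur] := geometric_dominated (fun n => le_trans (normr_cre_le _) (uC n)).
have [_ ui] := geometric_dominated (fun n => le_trans (normr_cim_le _) (uC n)).
by apply: le_trans (lerD ur ui) _; lra.
Qed.

Lemma csum_single u m : (forall n, n != m -> u n = 0) -> csum u = u m.
Proof.
move=> u0.
have sE (w : nat -> R) : (forall n, n != m -> w n = 0) -> limn (series w) = w m.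
  move=> w0; apply: cvg_lim => //; apply: cvg_near_cst; near=> n.
  have mn : (m < n)%N by near: n; exact: nbhs_infty_gt.
  rewrite /series/= big_mkord (bigD1 (Ordinal mn))//= big1 ?addr0// => i im.
  by apply: w0; apply: contra im => /eqP im; apply/eqP/val_inj.
rewrite /csum !sE//; first by case: (u m).
- by move=> n /u0 ->.
- by move=> n /u0 ->.
Unshelve. all: by end_near. Qed.

End complex_series.

Section differences.
Context {R : realType} {d : nat} (i0 : 'I_d).
Local Notation e0 := (delta_mx ord0 i0 : 'rV[R]_d).

Definition fdiff (V : zmodType) (t : R) (G : 'rV[R]_d -> V) (y : 'rV[R]_d) : V :=
  G y - G (y + t *: e0).

Lemma fdiff_mvt (u v : 'rV[R]_d -> R^o) (t B : R) y : 0 <= t ->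
  (forall y, is_derive y e0 u (v y)) -> (forall y, `|v y| <= B) ->
  `|fdiff t u y| <= t * B.
Proof.
move=> t0 du vB.
have dline s : is_derive (s : R^o) (1 : R^o) (fun s : R^o => u (y + s *: e0) : R^o) (v (y + s *: e0)).
  have [du1 du2] := du (y + s *: e0).
  have E : (fun h : R => h^-1 *: (((fun s : R^o => u (y + s *: e0) : R^o) \o
      shift (s : R^o)) (h *: (1 : R^o)) - u (y + s *: e0))) =
      (fun h : R => h^-1 *: ((u \o shift (y + s *: e0)) (h *: e0) - u (y + s *: e0))).
    apply/funext => h /=; congr (_ *: (u _ - _)).
    by rewrite -[h *: (1 : R^o)]/(h * 1) mulr1 scalerDl addrCA.
  split; first by rewrite /derivable E.
  by rewrite /derive E.
have cline : {within `[0, t], continuous (fun s : R => u (y + s *: e0))}.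
  apply: continuous_subspaceT => s; apply: (@differentiable_continuous _ R^o R^o).
  by apply/derivable1_diffP; have [] := dline s.
have [c _] := @MVT_segment R (fun s => u (y + s *: e0)) (fun s => v (y + s *: e0)) 0 t t0
  (fun s _ => dline s) cline.
rewrite scale0r addr0 subr0 /fdiff distrC => ->.
by rewrite normrM mulrC (ger0_norm t0) ler_wpM2l.
Qed.

(** The induction needs a whole tower [U] of successive directional derivatives: differencing every
    level gives another tower, and one mean value estimate bounds its level [M] by [t * B]. *)
Lemma iter_fdiff_mvt (M : nat) (U : nat -> 'rV[R]_d -> R^o) (t B : R) : 0 <= t ->
  (forall m y, is_derive y e0 (U m) (U m.+1 y)) -> (forall y, `|U M y| <= B) ->
  forall y, `|iter M (fdiff t) (U 0%N) y| <= t ^+ M * B.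
Proof.
move=> t0; elim: M U B => [|M ih] U B dU UB y; first by rewrite expr0 mul1r; exact: UB.
rewrite iterSr exprSr -mulrA.
apply: (ih (fun m => fdiff t (U m))) => [m {}y|{}y]; last first.
  exact: (@fdiff_mvt (U M) _ t B y t0 (dU M) UB).
have [h1 h2] := dU m y; have [h3 h4] := dU m (y + t *: e0).
have sh : is_derive y e0 (fun y => U m (y + t *: e0) : R^o) (U m.+1 (y + t *: e0)).
  have E : (fun h : R => h^-1 *: (((fun y => U m (y + t *: e0) : R^o) \o shift y)
      (h *: e0) - U m (y + t *: e0))) =
      (fun h : R => h^-1 *: ((U m \o shift (y + t *: e0)) (h *: e0) - U m (y + t *: e0))).
    by apply/funext => h /=; rewrite addrA.
  split; first by rewrite /derivable E.
  by rewrite /derive E.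
exact: is_deriveB.
Qed.

Lemma cre_iter_fdiff M t (G : 'rV[R]_d -> R[i]) y :
  cre (iter M (fdiff t) G y) = iter M (fdiff t) (fun y => cre (G y)) y.
Proof.
elim: M G => // M ih G; rewrite !iterSr ih; congr (iter M _ _ y).
by apply/funext => z; rewrite /fdiff creD; case: (G (z + _)).
Qed.

Lemma cim_iter_fdiff M t (G : 'rV[R]_d -> R[i]) y :
  cim (iter M (fdiff t) G y) = iter M (fdiff t) (fun y => cim (G y)) y.
Proof.
elim: M G => // M ih G; rewrite !iterSr ih; congr (iter M _ _ y).
by apply/funext => z; rewrite /fdiff cimD; case: (G (z + _)).
Qed.

Lemma measurable_shift t : measurable_fun setT (fun y : 'rV[R]_d => y + t *: e0).
Proof.
apply: measurable_fun_rVP => i.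
rewrite (_ : _ \o _ = (fun y : 'rV[R]_d => y ord0 i + (t *: e0) ord0 i)).
  by apply: measurable_funD => //; exact: measurable_coord.
by apply/funext => y /=; rewrite /rV_coord mxE.
Qed.

Lemma cmeasurable_iter_fdiff M t (G : 'rV[R]_d -> R[i]) :
  cmeasurable G -> cmeasurable (iter M (fdiff t) G).
Proof.
elim: M G => // M ih G mG; rewrite iterSr; apply: ih.
rewrite (_ : fdiff t G = (fun y => G y + (-1) * (G \o (fun y => y + t *: e0)) y)).
  apply: cmeasurableD => //; apply: cmeasurableM; first exact: cmeasurable_cst.
  by apply: cmeasurable_comp => //; exact: measurable_shift.
by apply/funext => y; rewrite /fdiff mulN1r.
Qed.

Lemma iter_fdiff_linear M t (a : R[i]) (G H : 'rV[R]_d -> R[i]) y :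
  iter M (fdiff t) (fun y => a * G y + H y) y =
  a * iter M (fdiff t) G y + iter M (fdiff t) H y.
Proof.
elim: M G H => // M ih G H; rewrite !iterSr -ih; congr (iter M _ _ y).
by apply/funext => z; rewrite /fdiff; ring.
Qed.

Definition fsum (t : R) (W : 'rV[R]_d -> R) (x : 'rV[R]_d) : R := W x + W (x - t *: e0).

Lemma iter_fsum_ge M t (W : 'rV[R]_d -> R) x : (forall x, 0 <= W x) ->
  W x <= iter M (fsum t) W x.
Proof.
elim: M W => // M ih W W0; rewrite iterSr.
apply: le_trans (ih _ _) => [|z]; first by rewrite lerDl.
exact: addr_ge0.
Qed.

Lemma iter_fsum_le M t (W : 'rV[R]_d -> R) x V : 0 <= t ->
  (forall s, 0 <= s <= M%:R * t -> W (x - s *: e0) <= V) ->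
  iter M (fsum t) W x <= 2 ^+ M * V.
Proof.
move=> t0; elim: M W V => [|M ih] W V WV.
  rewrite expr0 mul1r; have := WV 0; rewrite scale0r subr0; apply.
  by rewrite mul0r lexx.
rewrite iterSr exprSr -mulrA; apply: ih => s /andP[s0 sM].
rewrite /fsum mulrDl mul1r lerD//.
  by apply: WV; rewrite s0 (le_trans sM)// ler_wpM2r// ler_nat.
rewrite -addrA -opprD -scalerDl; apply: WV.
by rewrite addr_ge0//= -natr1 mulrDl mul1r lerD2r.
Qed.

Lemma measurable_iter_fsum M t (W : 'rV[R]_d -> R) :
  measurable_fun setT W -> measurable_fun setT (iter M (fsum t) W).
Proof.
elim: M W => // M ih W mW; rewrite iterSr; apply: ih.
apply: measurable_funD => //.
apply: (measurableT_comp mW).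
have := measurable_shift (- t).
by under eq_fun do rewrite scaleNr.
Qed.

End differences.

(** * Littlewood-Paley cutoffs *)

Section euclidean_norm.
Context {R : realType} {d : nat}.
Implicit Types (x : 'rV[R]_d).

Lemma normr_coord_le x i : `|x ord0 i| <= enorm x.
Proof.
rewrite -sqrtr_sqr ler_wsqrtr// /dotp (bigD1 i)//= -expr2 lerDl.
by apply: sumr_ge0 => k _; rewrite -expr2 sqr_ge0.
Qed.

Lemma enorm_le_sum x : enorm x <= \sum_i `|x ord0 i|.
Proof.
have s0 : 0 <= \sum_i `|x ord0 i| by apply: sumr_ge0.
rewrite -[leRHS]ger0_norm// -sqrtr_sqr ler_wsqrtr// expr2 /dotp mulr_suml.
apply: ler_sum => i _; apply: le_trans (ler_norm _) _; rewrite normrM ler_wpM2l//.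
by rewrite (bigD1 i)//= lerDl; apply: sumr_ge0.
Qed.

Lemma enormZ (a : R) x : enorm (a *: x) = `|a| * enorm x.
Proof.
rewrite /enorm -[`|a|]sqrtr_sqr -sqrtrM ?sqr_ge0//; congr Num.sqrt.
by rewrite /dotp mulr_sumr; apply: eq_bigr => i _; rewrite !mxE; ring.
Qed.

End euclidean_norm.

Section cutoff.
Context {R : realType} {d : nat} (phi : 'rV[R]_d -> R[i]) (hphi : lp_cutoff phi).

Lemma continuous_cutoff : continuous (fun xi => cre (phi xi)) /\ continuous (fun xi => cim (phi xi)).
Proof.
by split=> xi; apply: differentiable_continuous; have [] := (lp_smooth hphi).1 [::] xi.
Qed.

Lemma cmeasurable_cutoff : cmeasurable phi.
Proof.
by have [cr ci] := continuous_cutoff; split; exact: measurable_continuous_rV.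
Qed.

Lemma cutoff_support xi : phi xi != 0 -> 3 / 4 < enorm xi < 7 / 4.
Proof. by move=> p0; apply: (lp_supp hphi); exact: subset_closure. Qed.

Lemma cutoff_bounded : exists2 B, 0 <= B & forall xi, normc (phi xi) <= B.
Proof.
have [_ K] := lp_smooth hphi; have [cr ci] := continuous_cutoff.
have bd (u : 'rV[R]_d -> R) : continuous u -> (forall xi, phi xi = 0 -> u xi = 0) ->
    exists2 B, 0 <= B & forall xi, `|u xi| <= B.
  move=> cu u0.
  have : compact (u @` supp phi).
    by apply: continuous_compact => //; exact: continuous_subspaceT.
  move=> /compact_bounded[M [_ MB]].
  exists (`|M| + 1) => [|xi]; first by rewrite addr_ge0.
  have [p0|p0] := eqVneq (phi xi) 0; first by rewrite u0// normr0 addr_ge0.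
  apply: MB; first by rewrite (le_lt_trans (ler_norm _))// ltrDl.
  by exists xi => //; exact: subset_closure.
have [B1 B10 B1P] := bd _ cr (fun xi (e : phi xi = 0) => congr1 (@complex.Re R) e).
have [B2 B20 B2P] := bd _ ci (fun xi (e : phi xi = 0) => congr1 (@complex.Im R) e).
exists (B1 + B2); first exact: addr_ge0.
by move=> xi; rewrite (le_trans (normc_le_reim _))// lerD.
Qed.

(** Chosen so that [LP phi j f x] unfolds to [f (fourier (lp_test j x))]. *)
Definition lp_test (j : int) (x xi : 'rV[R]_d) : R[i] :=
  phi ((2 : R) ^ (- j) *: xi) * cexpi (2 * pi * dotp x xi).

Lemma cmeasurable_lp_test j x : cmeasurable (lp_test j x).
Proof.
apply: cmeasurableM; last first.
  apply: cmeasurable_cexpi; apply: measurable_funM => //; exact: measurable_dotp1.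
apply: (cmeasurable_comp cmeasurable_cutoff).
apply: measurable_fun_rVP => i.
rewrite (_ : _ \o _ = (fun xi : 'rV[R]_d => (2 : R) ^ (- j) * xi ord0 i)).
  by apply: measurable_funM => //; exact: measurable_coord.
by apply/funext => xi /=; rewrite /rV_coord mxE.
Qed.

Lemma lp_test_dominated j : exists2 H : 'rV[R]_d -> R,
  (lebesgue_rV d).-integrable setT (EFin \o H) &
  forall x xi, normc (lp_test j x xi) <= H xi.
Proof.
have [B B0 phiB] := cutoff_bounded.
(* The dilated cutoff lives in the ball of radius [7 / 4 * 2 ^ j], hence in the cube of half-side
   [L]. The majorant must not depend on [x], and the exponential has modulus 1. *)
pose L : R := 2 ^ j * 2.
pose T : 'rV[R]_d -> R := tensor (fun _ => (\1_`[- L, L] : R -> R)).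
exists (fun xi => B * T xi) => [|x xi].
  have iT : (lebesgue_rV d).-integrable setT (EFin \o T).
    by apply: integrable_tensor => i; exact: (@integrable_indic_itv _ (- L) L true false).
  exact: (integrableZl measurableT B iT).
rewrite normcM normc_cexpi mulr1.
have T0 : 0 <= T xi by apply: prodr_ge0.
have [->|/cutoff_support/andP[_]] := eqVneq (phi ((2 : R) ^ (- j) *: xi)) 0.
  by rewrite normc0 mulr_ge0.
rewrite enormZ => xiL; rewrite (_ : T xi = 1) ?mulr1//.
rewrite /T /tensor big1// => i _; rewrite indicE mem_set//= in_itv/= -ler_norml.
have j0 : 0 < (2 : R) ^ j by rewrite exprz_gt0.
have nj0 : 0 < (2 : R) ^ (- j) by rewrite exprz_gt0.
rewrite (le_trans (normr_coord_le xi i))//.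
move: xiL; rewrite gtr0_norm// -(ltr_pM2l j0) mulrA -expfzDr// subrr expr0z mul1r /L => xiL.
by rewrite (le_trans (ltW xiL))// ler_wpM2l ?ltW//; lra.
Qed.

(* The triangle around [2 ^ n] has its support in the region where exactly one
   dilate of the cutoff does not vanish, and where that dilate is [1]. *)
Lemma cutoff_tri (i0 : 'I_d) (delta : R) (n : nat) (j : int) xi :
  0 < delta -> d%:R * delta <= 1 / 8 ->
  tri_rV delta (2 ^+ n *: delta_mx ord0 i0) xi != 0 ->
  phi ((2 : R) ^ (- j) *: xi) = (j == n%:Z)%:R.
Proof.
move=> d0 dd /prodf_neq0 t0; set omega := 2 ^+ n *: delta_mx ord0 i0 in t0.
have pi2 := pi_ge2 R.
have near i : `|xi ord0 i - omega ord0 i| <= delta.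
  have := t0 i isT; rewrite /tri mulf_eq0 negb_or => /andP[_].
  rewrite leNgt; apply: contra => far.
  apply/eqP/max_idPl; rewrite subr_le0 -mulrBr normrM.
  rewrite (ger0_norm (_ : 0 <= 2 * pi)); last by rewrite mulr_ge0// pi_ge0.
  by rewrite (le_trans (ltW far))// ler_peMl//; lra.
have oE i : omega ord0 i = if i == i0 then 2 ^+ n else 0.
  by rewrite !mxE eqxx/=; case: ifP => _; rewrite ?mulr1 ?mulr0.
have p1 : 1 <= 2 ^+ n :> R by rewrite exprn_ege1// ler1n.
have d1 : delta <= 1 / 8.
  rewrite (le_trans _ dd)// ler_peMl ?(ltW d0)// ler1n.
  exact: leq_ltn_trans (ltn_ord i0).
(* The coordinate [i0] alone gives the lower bound, the l^1 norm gives the upper one; in both the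
   error is at most 1/8, which is at most [2 ^+ n / 8]. *)
have lo : 7 / 8 * 2 ^+ n <= enorm xi.
  rewrite (le_trans _ (normr_coord_le xi i0))//.
  by have := near i0; rewrite oE eqxx ler_norml => /andP[? ?]; rewrite (le_trans _ (ler_norm _))//; lra.
have hi : enorm xi <= 9 / 8 * 2 ^+ n.
  rewrite (le_trans (enorm_le_sum _))//.
  have : \sum_i `|xi ord0 i| <= \sum_i (`|omega ord0 i| + delta).
    apply: ler_sum => i _; rewrite -[in leLHS](subrK (omega ord0 i) (xi ord0 i)) addrC.
    by rewrite (le_trans (ler_normD _ _))// lerD.
  have -> : \sum_i (`|omega ord0 i| + delta) = 2 ^+ n + d%:R * delta.
    rewrite big_split/= sumr_const card_ord mulr_natl; congr (_ + _).
    rewrite (bigD1 i0)//= big1 ?addr0; first by rewrite oE eqxx ger0_norm//; lra.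
    by move=> i /negbTE ii; rewrite oE ii normr0.
  lra.
have jn0 : 0 < (2 : R) ^ (- j) by rewrite exprz_gt0.
have nE : enorm ((2 : R) ^ (- j) *: xi) = 2 ^ (- j) * enorm xi by rewrite enormZ gtr0_norm.
have pE : (2 : R) ^ (- j) * 2 ^+ n = 2 ^ (n%:Z - j).
  by rewrite exprnP -expfzDr// addrC.
have {}lo : 7 / 8 * 2 ^ (n%:Z - j) <= enorm ((2 : R) ^ (- j) *: xi).
  by rewrite nE -pE mulrCA ler_pM2l.
have {}hi : enorm ((2 : R) ^ (- j) *: xi) <= 9 / 8 * 2 ^ (n%:Z - j).
  by rewrite nE -pE [leRHS]mulrCA ler_pM2l.
have [jn|jn] := eqVneq j n%:Z.
  by apply: (lp_one hphi); move: lo hi; rewrite jn subrr expr0z; lra.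
apply/eqP/negPn/negP => /cutoff_support/andP[l r].
(* For [j < n] the rescaled point has norm at least 7/8 * 2 = 7/4, for [j > n] at most 9/8 / 2 =
   9/16 < 3/4. Both lie outside the open annulus, the first one just barely. *)
have [lt|] := ltP j n%:Z.
  have : (2 : R) ^ (1%:Z) <= 2 ^ (n%:Z - j).
    by rewrite ler_weXz2l ?ler1n//; move: lt; clear; lia.
  rewrite expr1z; lra.
rewrite le_eqVlt eq_sym (negbTE jn) /= => gt.
have : (2 : R) ^ (n%:Z - j) <= 2 ^ (-1)%Z.
  by rewrite ler_weXz2l ?ler1n//; move: gt; clear; lia.
rewrite exprN1; lra.
Qed.

End cutoff.

(** * Lacunary series *)

Lemma cintegrableB {R : realType} d (T : measurableType d) (mu : {measure set T -> \bar R})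
    (f g : T -> R[i]) :
  cintegrable mu f -> cintegrable mu g -> cintegrable mu (fun x => f x - g x).
Proof.
move=> [fr fi] [gr gi]; split.
- apply: eq_integrable (integrableB measurableT fr gr) => // x _ /=.
  by rewrite creD; case: (g x).
- apply: eq_integrable (integrableB measurableT fi gi) => // x _ /=.
  by rewrite cimD; case: (g x).
Qed.

Lemma cintB {R : realType} d (T : measurableType d) (mu : {measure set T -> \bar R})
    (f g : T -> R[i]) :
  cintegrable mu f -> cintegrable mu g ->
  cint mu (fun x => f x - g x) = cint mu f - cint mu g.
Proof.
move=> cf cg; rewrite -[in LHS](addrK (cint mu g) (cint mu _)); congr (_ - _).
rewrite -cintD//; last exact: cintegrableB.
by apply: eq_cint => x; rewrite subrK.
Qed.

Section family.
Context {R : realType} {d : nat} (i0 : 'I_d).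
Local Notation leb := (@lebesgue_rV R d).
Local Notation e0 := (delta_mx ord0 i0 : 'rV[R]_d).

Definition bdiff (t : R) (A : 'rV[R]_d -> R[i]) (x : 'rV[R]_d) : R[i] :=
  A x - A (x - t *: e0).

(** The hypothesis on [G] says that it depends on [x] and [y] through their difference along [e0],
    as the transform of a modulated cutoff does. A forward difference in [y] is then a backward
    difference in the parameter [x], which can be taken outside the integral. *)
Lemma cint_iter_fdiff M t (k : 'rV[R]_d -> R[i]) (G : 'rV[R]_d -> 'rV[R]_d -> R[i]) x :
  (forall x y, G x (y + t *: e0) = G (x - t *: e0) y) ->
  (forall x, cintegrable leb (fun y => k y * G x y)) ->
  cint leb (fun y => k y * iter M (fdiff i0 t) (G x) y) =
  iter M (bdiff t) (fun x => cint leb (fun y => k y * G x y)) x.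
Proof.
elim: M G x => // M ih G x Gt Gi.
pose G' x y := G x y - G (x - t *: e0) y.
have GE z : fdiff i0 t (G z) = G' z by apply/funext => y; rewrite /fdiff Gt.
rewrite iterSr GE ih => [|{}x y|{}x].
- rewrite iterSr; congr (iter M _ _ x); apply/funext => {}x; rewrite /bdiff /G'.
  by rewrite -cintB//; apply: eq_cint => y; rewrite mulrBr.
- by rewrite /G' !Gt.
- have := cintegrableB (Gi x) (Gi (x - t *: e0)).
  by rewrite /G'; under eq_fun do rewrite -mulrBr.
Qed.

Lemma iter_bdiff_wave M t (c : R[i]) (W : 'rV[R]_d -> R) (omega : 'rV[R]_d) x :
  2 * t * omega ord0 i0 = 1 ->
  iter M (bdiff t) (fun x => c * ((W x)%:C * cexpi (2 * pi * dotp x omega))) x =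
  c * ((iter M (fsum i0 t) W x)%:C * cexpi (2 * pi * dotp x omega)).
Proof.
move=> to; elim: M W x => // M ih W x; rewrite !iterSr -ih; congr (iter M _ _ x).
apply/funext => {}x; rewrite /bdiff /fsum.
have -> : 2 * pi * dotp (x - t *: e0) omega = 2 * pi * dotp x omega + - pi.
  rewrite dotpC dotpD dotpN dotpZ (dotpC omega x) mulrBr; congr (_ - _).
  rewrite (_ : dotp omega e0 = omega ord0 i0).
    by transitivity ((2 * t * omega ord0 i0) * pi); [ring|rewrite to mul1r].
  rewrite /dotp (bigD1 i0)//= !mxE !eqxx mulr1 big1 ?addr0// => i ii.
  by rewrite mxE (negbTE ii) andbF mulr0.
have Npi : cexpi (- pi) = -1 :> R[i].
  by apply: complexP; rewrite /= ?cosN ?sinN ?cospi ?sinpi ?oppr0.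
by rewrite cexpiD Npi rmorphD; ring.
Qed.

End family.

Section lacunary.
Context {R : realType} {d : nat} (i0 : 'I_d) (phi : 'rV[R]_d -> R[i]) (hphi : lp_cutoff phi).
Variables (s : R) (c : nat -> R) (M : nat).
Hypothesis c0 : forall n, 0 <= c n.
Local Notation leb := (@lebesgue_rV R d).
Local Notation e0 := (delta_mx ord0 i0 : 'rV[R]_d).

Implicit Types x : 'rV[R]_d.

(** The largest width for which [cutoff_tri] applies, where [d%:R * delta <= 1 / 8] is required. *)
Definition width : R := (8 * d%:R)^-1.
Definition freq n : 'rV[R]_d := 2 ^+ n *: e0.
Definition half_period n : R := (2 ^+ n.+1)^-1.
Definition amplitude n : R := c n * 2 `^ (- (n%:R * s)).

(* A shift by half a period changes the sign of the [n]-th wave. Transferred to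
   the packet, the [M]-th difference therefore only adds up translates of the
   envelope, while on a Schwartz function it gains a factor [2 ^ (- n M)], which
   makes the series converge for every [s]. *)
Definition packet_pairing n (g : 'rV[R]_d -> R[i]) : R[i] :=
  cint leb (fun y => wave_packet width (freq n) y * iter M (fdiff i0 (half_period n)) g y).

Definition lacunary (g : 'rV[R]_d -> R[i]) : R[i] :=
  csum (fun n => (amplitude n)%:C * packet_pairing n g).

Definition envelope n : 'rV[R]_d -> R :=
  iter M (fsum i0 (half_period n)) (kern_rV width).

Let dpos : 0 < d%:R :> R.
Proof. by rewrite ltr0n (leq_ltn_trans _ (ltn_ord i0)). Qed.

Lemma width_gt0 : 0 < width.
Proof. by rewrite invr_gt0 mulr_gt0. Qed.

Lemma half_period_ge0 n : 0 <= half_period n.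
Proof. by rewrite invr_ge0 exprn_ge0. Qed.

(** The differences are moved from [y] to [x] first, because the pairing is known in closed form as
    a function of [x] ([pairing_fourier]), whereas the transform of the cutoff is not explicit in
    [y]. *)
Lemma packet_pairing_test n (j : int) x :
  packet_pairing n (fourier (lp_test phi j x)) =
  (j == n%:Z)%:R * ((envelope n x)%:C * cexpi (2 * pi * dotp x (freq n))).
Proof.
have [H iH hH] := lp_test_dominated hphi j.
rewrite /packet_pairing (@cint_iter_fdiff _ _ i0 M (half_period n) (wave_packet width (freq n))
  (fun x => fourier (lp_test phi j x))).
- rewrite -iter_bdiff_wave; last first.
    by rewrite !mxE !eqxx mulr1 /half_period exprS; field; rewrite expf_neq0.
  congr (iter M _ _ x); apply/funext => {}x.
  apply: (pairing_fourier (cmeasurable_lp_test hphi j x) iH (hH x) width_gt0) => xi t0.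
  rewrite /lp_test (@cutoff_tri _ _ _ hphi i0 width n j xi width_gt0 _ t0)//.
  by rewrite /width invfM mulrCA mulfV ?gt_eqF// mulr1 mul1r.
- move=> {}x y; apply: eq_cint => xi; rewrite /lp_test -!mulrA -!cexpiD.
  congr (_ * cexpi _); rewrite dotpD dotpZ.
  by rewrite [in RHS]dotpC dotpD dotpN dotpZ (dotpC xi x); ring.
- by move=> {}x; exact: (cintegrable_wave_packet_fourier _ _ (cmeasurable_lp_test hphi j x) iH (hH x)).
Qed.

Lemma LP_lacunary n x :
  LP phi n%:Z lacunary x = (amplitude n * envelope n x)%:C * cexpi (2 * pi * dotp x (freq n)).
Proof.
rewrite [LHS](_ : _ = lacunary (fourier (lp_test phi n x)))// /lacunary.
rewrite (@csum_single _ _ n) => [|m mn]; rewrite packet_pairing_test.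
  by rewrite eqxx mul1r mulrA -rmorphM.
by rewrite eqz_nat eq_sym (negbTE mn) mul0r mulr0.
Qed.

Lemma LP_lacunary_Negz n x : LP phi (Negz n) lacunary x = 0.
Proof.
rewrite [LHS](_ : _ = lacunary (fourier (lp_test phi (Negz n) x)))// /lacunary.
(* Every term vanishes, as the packets only have frequencies [2 ^+ n] with n >= 0; the index 0
   singled out here is arbitrary. *)
by rewrite (@csum_single _ _ 0) => [|m _]; rewrite packet_pairing_test mul0r mulr0.
Qed.

Lemma kern_ge0 delta t : 0 <= kern delta t :> R.
Proof.
rewrite mulr_ge0 ?(ltW (fejer_mass_gt0))//; case: ifPn => _.
  by rewrite divr_ge0 ?sqr_ge0// mulr_ge0// pi_ge0.
by rewrite divr_ge0 ?one_sub_cos_ge0// mulr_ge0 ?pi_ge0// sqr_ge0.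
Qed.

Lemma kern_rV_ge0 x : 0 <= kern_rV width x.
Proof. by apply: prodr_ge0 => i _; exact: kern_ge0. Qed.

Lemma envelope_ge n x : kern_rV width x <= envelope n x.
Proof. by apply: iter_fsum_ge; exact: kern_rV_ge0. Qed.

Lemma envelope_ge0 n x : 0 <= envelope n x.
Proof. exact: le_trans (kern_rV_ge0 x) (envelope_ge n x). Qed.

Lemma amplitude_ge0 n : 0 <= amplitude n.
Proof. by rewrite mulr_ge0// powR_ge0. Qed.

Lemma normc_LP_lacunary n x :
  2 `^ (n%:R * s) * normc (LP phi n%:Z lacunary x) = c n * envelope n x.
Proof.
rewrite LP_lacunary normcM normc_cexpi mulr1 normc_real ger0_norm; last first.
  by rewrite mulr_ge0 ?amplitude_ge0 ?envelope_ge0.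
rewrite mulrA /amplitude mulrCA -powRD; last by rewrite pnatr_eq0 implybT.
by rewrite subrr powRr0 mulr1.
Qed.

Lemma measurable_kern delta : measurable_fun setT (@kern R delta).
Proof.
apply: measurable_funM => //; apply: measurable_fun_ifT => //.
- exact: measurable_fun_eqr.
- have -> : (fun t => (1 - cos (delta * t)) / (pi * t ^+ 2)) =
     (fun t => pi^-1 * fejer delta t) :> (R -> R).
    by apply/funext => t; rewrite /fejer invfM mulrCA mulrA.
  by apply: measurable_funM => //; exact: measurable_fejer.
Qed.

Lemma measurable_envelope n : measurable_fun setT (envelope n).
Proof. by apply: measurable_iter_fsum; apply: measurable_tensor => i; exact: measurable_kern. Qed.

Definition kern_bound : R := fejer_mass * (width ^+ 2 / 2 + 2).

(* Since [pi >= 1], both branches of [kern] are covered by the bound for [fejer]. *)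
Lemma kern_le t : kern width t <= kern_bound * (1 + t ^+ 2)^-1 :> R.
Proof.
have pi2 := pi_ge2 R.
rewrite /kern /kern_bound -mulrA ler_wpM2l ?(ltW (fejer_mass_gt0))//.
case: ifPn => [/eqP ->|t0].
  rewrite expr0n/= addr0 invr1 mulr1.
  have w0 := sqr_ge0 width.
  have : width ^+ 2 / (2 * pi) <= width ^+ 2 / 2.
    by rewrite ler_wpM2l// lef_pV2 ?posrE; lra.
  lra.
apply: le_trans (fejer_le width t); rewrite /fejer ler_wpM2l ?one_sub_cos_ge0//.
have t20 : 0 < t ^+ 2 by rewrite exprn_even_gt0.
have p0 : 0 < pi * t ^+ 2 by rewrite mulr_gt0 ?pi_gt0.
rewrite lef_pV2 ?posrE//.
by rewrite ler_peMl ?(ltW t20)//; lra.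
Qed.

Lemma kern_bound_gt0 : 0 < kern_bound.
Proof. by rewrite mulr_gt0 ?fejer_mass_gt0// ltr_wpDl// divr_ge0// sqr_ge0. Qed.

(* The shifts entering [envelope n] stay below [M]. *)
Definition majorant : 'rV[R]_d -> R := fun x => 2 ^+ M * (kern_bound ^+ d *
  (2 + 2 * M%:R ^+ 2)) * tensor (fun _ t => (1 + t ^+ 2)^-1) x.

Lemma envelope_le n x : envelope n x <= majorant x.
Proof.
rewrite /majorant -!mulrA; apply: iter_fsum_le => [|t /andP[t0 tM]].
  exact: half_period_ge0.
have {}tM : t <= M%:R.
  rewrite (le_trans tM)// ler_piMr// invf_le1 ?exprn_gt0//.
  by rewrite exprn_ege1// ler1n.
have step : kern_rV width (x - t *: e0) <= kern_bound ^+ d *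
    tensor (fun _ t => (1 + t ^+ 2)^-1) (x - t *: e0).
  rewrite -[X in _ ^+ X](card_ord d) -prodr_const -big_split /=.
  by apply: ler_prod => i _; rewrite kern_ge0 kern_le.
apply: le_trans step _.
rewrite ler_wpM2l ?exprn_ge0 ?(ltW kern_bound_gt0)//.
rewrite /tensor (bigD1 i0)//= [in leRHS](bigD1 i0)//= mulrA.
have pos (u : R) : 0 < 1 + u ^+ 2 by rewrite ltr_pwDl// sqr_ge0.
rewrite ler_pM ?invr_ge0 ?(ltW (pos _))//.
- by apply: prodr_ge0 => i _; rewrite invr_ge0 (ltW (pos _)).
- rewrite !mxE !eqxx mulr1; set u := x ord0 i0.
  rewrite ler_pdivlMr// mulrC ler_pdivrMr//.
  (* A Peetre-type inequality, from u^2 <= 2 (u - t)^2 + 2 t^2. Only the coordinate [i0] is shifted,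
     so this factor enters [majorant] once and not to the power [d]. *)
  have : (1 + u ^+ 2) <= (2 + 2 * t ^+ 2) * (1 + (u - t) ^+ 2).
    have := sqr_ge0 (u - 2 * t); have := sqr_ge0 (t * (u - t)); have := sqr_ge0 t; rewrite !expr2; nra.
  move=> H; apply: le_trans H _; rewrite ler_wpM2r ?(ltW (pos _))//.
  by rewrite lerD2l ler_wpM2l// lerXn2r ?nnegrE.
- rewrite le_eqVlt; apply/orP; left; apply/eqP; apply: eq_bigr => i ii.
  by rewrite !mxE (negbTE ii) andbF mulr0 subr0.
Qed.

End lacunary.

(** * Continuity of the lacunary series on Schwartz functions *)

Section dual.
Context {R : realType} {d : nat} (i0 : 'I_d).
Variables (s : R) (c : nat -> R) (M : nat).
Hypotheses (c0 : forall n, 0 <= c n) (c1 : forall n, c n <= 1) (sM : 1 - s <= M%:R).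
Local Notation leb := (@lebesgue_rV R d).
Local Notation width := (@width R d).
Implicit Types (g : 'rV[R]_d -> R[i]) (y : 'rV[R]_d).

Lemma cmeasurable_csmooth g : csmooth g -> cmeasurable g.
Proof.
move=> sg; split; apply: measurable_continuous_rV => x; apply: differentiable_continuous;
  by have [] := sg [::] x.
Qed.

Lemma schwartz_norm_ge N g al y : (size al <= N)%N ->
  ((normc (cpartials al g y))%:E <= schwartz_norm N g)%E.
Proof.
move=> alN; apply: (@le_trans _ _ ((1 + enorm y) ^+ N * normc (cpartials al g y))%:E).
  by rewrite lee_fin ler_peMl ?normc_ge0//= exprn_ege1// lerDl sqrtr_ge0.
by apply: ereal_sup_ubound; exists (al, y).
Qed.

Lemma schwartz_norm_ge0 N g : (0 <= schwartz_norm N g)%E.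
Proof.
apply: le_trans (@schwartz_norm_ge N g [::] 0 (leq0n N)).
by rewrite lee_fin normc_ge0.
Qed.

Lemma schwartz_norm_fin N g : schwartz g -> schwartz_norm N g \is a fin_num.
Proof.
by move=> [_ /(_ N) gN]; rewrite ge0_fin_numE// schwartz_norm_ge0.
Qed.

Lemma normc_iter_fdiff t g y : schwartz g -> 0 <= t ->
  normc (iter M (fdiff i0 t) g y) <= 2 * (t ^+ M * fine (schwartz_norm M g)).
Proof.
move=> sg t0; rewrite (le_trans (normc_le_reim _))// mulrDl mul1r.
have gS z : normc (cpartials (nseq M i0) g z) <= fine (schwartz_norm M g).
  rewrite -lee_fin fineK ?schwartz_norm_fin//; apply: schwartz_norm_ge.
  by rewrite size_nseq.
have dP (u : 'rV[R]_d -> R) : (forall m x, differentiable (partials (nseq m i0) u) x) ->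
    forall m x, is_derive x (delta_mx ord0 i0 : 'rV[R]_d) (partials (nseq m i0) u : _ -> R^o)
      (partials (nseq m.+1 i0) u x).
  by move=> du m x; split => //; exact: diff_derivable.
rewrite lerD// ?cre_iter_fdiff ?cim_iter_fdiff.
- apply: (@iter_fdiff_mvt _ _ i0 M (fun m => partials (nseq m i0) (fun y => cre (g y)))) => // [m x|z].
    by apply: dP => {}m {}x; have [] := sg.1 (nseq m i0) x.
  by rewrite (le_trans _ (gS z))// (le_trans _ (normr_cre_le _)).
- apply: (@iter_fdiff_mvt _ _ i0 M (fun m => partials (nseq m i0) (fun y => cim (g y)))) => // [m x|z].
    by apply: dP => {}m {}x; have [] := sg.1 (nseq m i0) x.
  by rewrite (le_trans _ (gS z))// (le_trans _ (normr_cim_le _)).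
Qed.

Let J := \int[leb]_y fejer_rV width y.

Let packet n g y := wave_packet width (freq i0 n) y * iter M (fdiff i0 (half_period n)) g y.

Lemma cmeasurable_packet n g : schwartz g -> cmeasurable (packet n g).
Proof.
move=> sg; apply: cmeasurableM; first exact: cmeasurable_wave_packet.
by apply: cmeasurable_iter_fdiff; apply: cmeasurable_csmooth; exact: sg.1.
Qed.

Lemma normc_packet n g y : schwartz g -> normc (packet n g y) <=
  2 * (half_period n ^+ M * fine (schwartz_norm M g)) * fejer_rV width y.
Proof.
move=> sg; rewrite normcM normc_wave_packet mulrC ler_wpM2r ?fejer_rV_ge0//.
by rewrite normc_iter_fdiff// half_period_ge0.
Qed.

Lemma integrable_packet_bound k : leb.-integrable setT (EFin \o (fun y => k * fejer_rV width y)).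
Proof. exact: (integrableZl measurableT k (integrable_fejer_rV d width)). Qed.

(** This is where [1 - s <= M%:R] enters: n s + (n+1) M >= n because n (s + M - 1) >= 0. *)
Lemma amplitude_half_period n : amplitude s c n * half_period n ^+ M <= (2 ^+ n)^-1.
Proof.
have -> : half_period n ^+ M = 2 `^ (- (n.+1%:R * M%:R)) :> R.
  by rewrite /half_period powRN powRrM !powR_mulrn ?exprn_ge0// exprVn.
have -> : (2 ^+ n)^-1 = 2 `^ (- n%:R) :> R by rewrite powRN powR_mulrn.
apply: (@le_trans _ _ (2 `^ (- (n%:R * s)) * 2 `^ (- (n.+1%:R * M%:R)))).
  by rewrite ler_wpM2r ?powR_ge0// /amplitude ler_piMl// powR_ge0.
rewrite -powRD; last by rewrite pnatr_eq0 implybT.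
rewrite ler_powR ?ler1n//.
have n0 : 0 <= n%:R :> R by []. have M0 : 0 <= M%:R :> R by [].
have sM' : 0 <= s + M%:R - 1 by rewrite subr_ge0 -lerBlDl.
by have := mulr_ge0 n0 sM'; rewrite -natr1; lra.
Qed.

Lemma term_le n g : schwartz g ->
  normc ((amplitude s c n)%:C * packet_pairing i0 M n g) <=
  4 * J * fine (schwartz_norm M g) / 2 ^+ n.
Proof.
move=> sg; set S := fine _.
have S0 : 0 <= S by rewrite fine_ge0// schwartz_norm_ge0.
have J0 : 0 <= J by apply: Rintegral_ge0 => y _; exact: fejer_rV_ge0.
have a0 := amplitude_ge0 s c0 n.
rewrite normcM normc_real ger0_norm//.
have := normc_cint_le (cmeasurable_packet n sg) (integrable_packet_bound _) (fun y => normc_packet n y sg).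
rewrite RintegralZl//; last exact: integrable_fejer_rV.
move=> /(ler_wpM2l a0) H; apply: le_trans H _.
rewrite [leLHS](_ : _ = (4 * J * S) * (amplitude s c n * half_period n ^+ M)); last first.
  by rewrite -/S -/J; ring.
by rewrite ler_wpM2l ?mulr_ge0// amplitude_half_period.
Qed.

Lemma packet_pairing_linear n (a : R[i]) g h : schwartz g -> schwartz h ->
  packet_pairing i0 M n (fun y => a * g y + h y) =
  a * packet_pairing i0 M n g + packet_pairing i0 M n h.
Proof.
move=> sg sh.
have ci u (su : schwartz u) : cintegrable leb (packet n u).
  exact: (cintegrable_dominated (cmeasurable_packet n su) (integrable_packet_bound _)
    (fun y => normc_packet n y su)).
have cZ : cintegrable leb (fun y => a * packet n g y).
  apply: (@cintegrable_dominated _ _ _ _ _ (fun y => normc a *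
    (2 * (half_period n ^+ M * fine (schwartz_norm M g)) * fejer_rV width y))).
  - by apply: cmeasurableM; [exact: cmeasurable_cst|exact: cmeasurable_packet].
  - exact: (integrableZl measurableT _ (integrable_packet_bound _)).
  - by move=> y; rewrite normcM ler_wpM2l ?normc_ge0// normc_packet.
rewrite /packet_pairing -/(packet n g) -/(packet n h) -cintZ//; last exact: ci.
rewrite -cintD//; last exact: ci.
by apply: eq_cint => y; rewrite iter_fdiff_linear /packet; ring.
Qed.

Lemma lacunary_dual : schwartz_infty_dual (lacunary i0 s c M).
Proof.
split=> [a g h [sg _] [sh _]|].
  rewrite /lacunary -(csum_linear a (fun n => term_le n sg) (fun n => term_le n sh)).
  congr csum; apply/funext => n.
  by rewrite packet_pairing_linear//; ring.
(* [term_le] supplies [4 * J]; another 4 comes from the geometric series, 2 for each of the real and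
   imaginary parts. *)
exists M, (16 * J) => g [sg _].
rewrite -(fineK (schwartz_norm_fin M sg)) -EFinM lee_fin.
apply: le_trans (normc_csum (fun n => term_le n sg)) _.
by rewrite le_eqVlt; apply/orP; left; apply/eqP; ring.
Qed.

End dual.

(** * Power sums and power integrals *)

Section series_and_integrals.
Context {R : realType}.

(** The integral of a nonnegative function is a supremum over the simple functions below it, hence
    monotone for arbitrary functions. It is applied to [tl_fun] and to measures of level sets as
    functions of the level. *)
Lemma ge0_le_integral_nonmeasurable d (T : measurableType d) (mu : {measure set T -> \bar R}) (D : set T)
    (f g : T -> \bar R) :
  (forall x, D x -> 0 <= f x)%E -> (forall x, D x -> f x <= g x)%E ->
  (\int[mu]_(x in D) f x <= \int[mu]_(x in D) g x)%E.
Proof.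
move=> f0 fg; have g0 x : D x -> (0 <= g x)%E.
  by move=> Dx; exact: le_trans (f0 _ Dx) (fg _ Dx).
rewrite !ge0_integralE//; apply: le_ereal_sup => _ /= [h hf <-].
exists h => //= x; apply: le_trans (hf x) _; rewrite !patchE.
by case: ifPn => //; rewrite inE; exact: fg.
Qed.

Lemma esum_int (a : int -> \bar R) :
  (forall k, 0 <= a k)%E -> (forall n, a (Negz n) = 0%E) ->
  \esum_(k in [set: int]) a k = (\sum_(0 <= n <oo) a (Posz n))%E.
Proof.
move=> a0 aN.
rewrite nneseries_esumT// -(@reindex_esum R _ _ setT (range Posz) Posz a); last first.
  by split=> [n _|m n _ _ [->]//|k [n _ <-]]; exists n.
rewrite [RHS]esum_mkcond; apply: eq_esum => k _.
case: k => n; first by rewrite mem_set//; exists n.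
by rewrite memNset ?aN// => -[].
Qed.

Lemma nneseries_le (u : nat -> R) B : (forall n, 0 <= u n) ->
  (forall n, \sum_(0 <= i < n) u i <= B) -> (\sum_(0 <= n <oo) (u n)%:E <= B%:E)%E.
Proof.
move=> u0 uB; apply: lime_le.
  by apply: is_cvg_nneseries => n _ _; rewrite lee_fin.
by apply: nearW => n; rewrite sumEFin lee_fin.
Qed.

Lemma powR_sub_ge (e x : R) : 0 <= e -> 0 < x ->
  e * (x + 1) `^ (- (1 + e)) <= x `^ (- e) - (x + 1) `^ (- e).
Proof.
move=> e0 x0; have x10 : 0 < x + 1 by rewrite addr_gt0.
set y := x / (x + 1).
have y0 : 0 < y by rewrite divr_gt0.
have xE : x = (x + 1) * y by rewrite /y mulrC divfK// gt_eqF.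
have -> : (x + 1) `^ (- (1 + e)) = (x + 1) `^ (- e) * (x + 1)^-1.
  by rewrite opprD (addrC (-1)) powRD ?powR_inv1 ?(ltW x10)// (gt_eqF x10) implybT.
have -> : x `^ (- e) = (x + 1) `^ (- e) * y `^ (- e).
  by rewrite -powRM ?(ltW x10) ?(ltW y0)// -xE.
rewrite mulrCA -[X in _ - X]mulr1 -mulrBr ler_wpM2l ?powR_ge0//.
rewrite lerBrDl /powR gt_eqF//; apply: le_trans (expR_ge1Dx _).
rewrite lerD2l mulNr -mulrN ler_wpM2l//.
have yE : y = 1 + - (x + 1)^-1.
  by rewrite /y; field; rewrite gt_eqF.
rewrite lerNr yE le_ln1Dx// ltrN2 invf_lt1//; lra.
Qed.

Lemma nneseries_powR_lty (b : R) : 1 < b ->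
  (\sum_(0 <= n <oo) (n.+1%:R `^ (- b))%:E < +oo)%E.
Proof.
move=> b1; pose e := b - 1; have e0 : 0 < e by rewrite subr_gt0.
have bE : b = 1 + e by rewrite /e; ring.
apply: (@le_lt_trans _ _ (1 + e^-1)%:E); last exact: ltry.
apply: nneseries_le => n; first exact: powR_ge0.
suff H m : \sum_(0 <= i < m.+1) i.+1%:R `^ (- b) <= 1 + e^-1 * (1 - m.+1%:R `^ (- e)).
  have m0 m : 0 <= m.+1%:R `^ (- e) :> R by exact: powR_ge0.
  case: n => [|n]; first by rewrite big_geq// addr_ge0// invr_ge0 ltW.
  by rewrite (le_trans (H n))// lerD2l ler_piMr ?invr_ge0 ?(ltW e0)//; have := m0 n; lra.
elim: m => [|m ih]; first by rewrite big_nat1 !mulr1n !powR1 subrr mulr0 addr0.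
rewrite big_nat_recr//=; have := @powR_sub_ge e m.+1%:R (ltW e0) (ltr0Sn _ _).
rewrite -bE [m.+1%:R + 1]natr1 => H.
have {}H : m.+2%:R `^ (- b) <= e^-1 * (m.+1%:R `^ (- e) - m.+2%:R `^ (- e)).
  by rewrite mulrC ler_pdivlMr// mulrC.
apply: le_trans (lerD ih H) _; rewrite -addrA lerD2l -mulrDr ler_wpM2l ?invr_ge0 ?(ltW e0)//.
by rewrite addrA subrK.
Qed.

Lemma nneseries_powR_pinfty (b : R) : 0 <= b <= 1 ->
  (\sum_(0 <= n <oo) (n.+1%:R `^ (- b))%:E = +oo)%E.
Proof.
move=> b01; apply/eqP; rewrite eq_le leey/= leNgt; apply/negP => H.
have := dvg_riemannR b01; apply.
have -> : riemannR b = (fun n => n.+1%:R `^ (- b)) by apply/funext => n; rewrite powRN.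
by apply: nnseries_is_cvg => // n; exact: powR_ge0.
Qed.

Lemma nneseries_count_le (X : R) : 0 <= X ->
  (\sum_(0 <= n <oo) ((n.+1%:R < X)%R%:R : R)%:E <= X%:E)%E.
Proof.
move=> X0; apply: nneseries_le => // n.
(* The bound [X] alone is not inductive; keeping [m%:R] as well controls the count while all indices
   still qualify. *)
have H m : \sum_(0 <= i < m) ((i.+1%:R < X)%R%:R : R) <= Num.min m%:R X.
  elim: m => [|m ih]; first by rewrite big_geq// le_min lexx X0.
  rewrite big_nat_recr//=; move: ih; rewrite !le_min => /andP[h1 h2].
  have [mX|mX] := ltP m.+1%:R X; last by rewrite addr0 h2 andbT (le_trans h1)// ler_nat.
  rewrite -[m.+1%:R]natr1 lerD2r h1/=.
  by rewrite (le_trans _ (ltW mX))// -[leRHS]natr1 lerD2r.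
by apply: le_trans (H n) _; rewrite ge_min lexx orbT.
Qed.

Lemma integral_powR_lty (theta A : R) : 0 <= theta < 1 -> 0 < A ->
  (\int[@lebesgue_measure R]_(l in `]0%R, A]) (l `^ (- theta))%:E < +oo)%E.
Proof.
move=> /andP[t0 t1] A0.
(* The offset 2 keeps the left end strictly below [A] already at [i = 0], as the fundamental theorem
   of calculus requires. *)
pose F i : set R := [set` `[A / i.+2%:R, A]].
have FE : `]0%R, A]%classic = \bigcup_i F i.
  apply/seteqP; split=> [l|l [i _]]; rewrite /F /= !in_itv/=.
    move=> /andP[l0 lA].
    have [n _ nl] := near_infty_natSinv_lt (PosNum (divr_gt0 l0 A0)).
    exists n => //=; rewrite in_itv/= lA andbT.
    have := nl n.+1 (leqnSn n) => /= /ltW.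
    by rewrite ler_pdivlMr// mulrC.
  by move=> /andP[lA ->]; rewrite andbT (lt_le_trans _ lA)// divr_gt0.
have dF (a x : R) : 0 < x -> is_derive (x : R^o) (1 : R^o)
    (fun z : R^o => (z : R) `^ a : R^o) (a * x `^ (a - 1)).
  exact: is_derive1_powR.
have cP (a x : R) : 0 < x -> {for x, continuous (fun z : R => z `^ a)}.
  by move=> x0; apply: (@differentiable_continuous _ R^o R^o); apply/derivable1_diffP; have [] := dF a x x0.
have Apos i : 0 < A / i.+2%:R by rewrite divr_gt0.
have ltA i : A / i.+2%:R < A by rewrite ltr_pdivrMr// ltr_pMr// ltr1n.
have inF i l : F i l -> 0 < l.
  by rewrite /F/= in_itv/= => /andP[h _]; exact: lt_le_trans h.
have st0 : 0 < 1 - theta by rewrite subr_gt0.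
have IF i : (\int[@lebesgue_measure R]_(l in F i) (l `^ (- theta))%:E <=
    (A `^ (1 - theta) / (1 - theta))%:E)%E.
  rewrite (@continuous_FTC2 _ _ (fun l => (1 - theta)^-1 * l `^ (1 - theta)))//.
  - rewrite -EFinB lee_fin mulrC lerBlDr lerDl mulr_ge0 ?powR_ge0//.
    by rewrite invr_ge0 ltW.
  - by apply: continuous_in_subspaceT => l; rewrite inE => /inF; exact: cP.
  - split.
    + move=> l; rewrite in_itv/= => /andP[Al _].
      by apply: derivableM => //; have [] := dF (1 - theta) l (lt_trans (Apos i) Al).
    + apply: cvg_at_right_filter; apply: cvgM; first exact: cvg_cst.
      exact: cP.
    + apply: cvg_at_left_filter; apply: cvgM; first exact: cvg_cst.
      exact: cP.
  - move=> l; rewrite in_itv/= => /andP[Al _].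
    have [d1 d2] := dF (1 - theta) l (lt_trans (Apos i) Al).
    rewrite derive1E deriveM// d2 derive_cst scaler0 addr0 /GRing.scale/=.
    by rewrite mulKf ?gt_eqF// addrAC subrr add0r.
apply: (@le_lt_trans _ _ (A `^ (1 - theta) / (1 - theta))%:E); last exact: ltry.
rewrite FE.
have nd : nondecreasing_seq F.
  apply/nondecreasing_seqP => n; rewrite subsetEset => l; rewrite /F/= !in_itv/= => /andP[h ->].
  by rewrite andbT (le_trans _ h)// ler_pM2l// lef_pV2 ?posrE// ler_nat.
have mF i : measurable (F i) by exact: measurable_itv.
have mf i : measurable_fun (F i) (fun l : measurableTypeR R => (l `^ (- theta))%:E).
  by apply: measurable_funTS; apply/measurable_EFinP; exact: measurable_powR.
have f0 i l : F i l -> (0 <= (l `^ (- theta))%:E)%E by rewrite lee_fin powR_ge0.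
have cv := @ge0_nondecreasing_set_cvg_integral _ (measurableTypeR R) R F
  (fun l => (l `^ (- theta))%:E) lebesgue_measure nd mF mf f0.
rewrite -(cvg_lim _ cv)//; apply: lime_le; last by apply: nearW => i; exact: IF.
exact: cvgP cv.
Qed.

End series_and_integrals.

(** * Bounds for the envelopes *)

Lemma measurable_fun_slices {R : realType} d (u : 'rV[R]_d * int -> R) :
  (forall k, measurable_fun setT (fun x => u (x, k))) -> measurable_fun setT u.
Proof.
move=> mu _ B mB; rewrite setTI.
rewrite (_ : u @^-1` B = \bigcup_(k in setT) (((fun x => u (x, k)) @^-1` B) `*` [set k])); last first.
  apply/seteqP; split=> [[x k] Bu|[x k] [j _ [/= Bu ->]]]//.
  by exists k.
apply: countable_bigcupT_measurable => [|k]; first exact: countableP.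
by apply: measurableX => //; rewrite -[X in measurable X]setTI; exact: mu.
Qed.

Lemma cmeasurable_slices {R : realType} d (g : 'rV[R]_d * int -> R[i]) :
  (forall k, cmeasurable (fun x => g (x, k))) -> cmeasurable g.
Proof. by move=> mg; split; apply: measurable_fun_slices => k; have [] := mg k. Qed.

Section majorant.
Context {R : realType} {d : nat} (M : nat).
Local Notation leb := (@lebesgue_rV R d).
Local Notation W := (@majorant R d M).

Definition majorant_sup : R := 2 ^+ M * (@kern_bound R d ^+ d * (2 + 2 * M%:R ^+ 2)).

Lemma majorant_sup_gt0 : 0 < majorant_sup.
Proof.
by rewrite mulr_gt0 ?exprn_gt0// mulr_gt0 ?exprn_gt0 ?kern_bound_gt0// ltr_pwDl// mulr_ge0.
Qed.

Lemma majorant_ge0 x : 0 <= W x.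
Proof.
rewrite mulr_ge0 ?(ltW majorant_sup_gt0)//; apply: prodr_ge0 => i _.
by rewrite invr_ge0 addr_ge0// sqr_ge0.
Qed.

Lemma majorant_le x : W x <= majorant_sup.
Proof.
rewrite ler_piMr ?(ltW majorant_sup_gt0)//.
apply: prodr_ile1 => i _; rewrite invr_ge0 addr_ge0 ?sqr_ge0//=.
by rewrite invf_le1 ?lerDl ?sqr_ge0// ltr_pwDl// sqr_ge0.
Qed.

Lemma integrable_majorant : leb.-integrable setT (EFin \o W).
Proof.
have iT : leb.-integrable setT (EFin \o (tensor (fun=> (fun t : R => (1 + t ^+ 2)^-1)) : 'rV[R]_d -> R)).
  by apply: integrable_tensor => i; exact: integrable_oneDsqrV.
exact: (integrableZl measurableT majorant_sup iT).
Qed.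

Lemma measurable_majorant : measurable_fun setT W.
Proof. by apply/measurable_EFinP; exact: measurable_int integrable_majorant. Qed.

Lemma measurable_majorant_powR q : measurable_fun setT (fun x => W x `^ q).
Proof. exact: (measurableT_comp (measurable_powR q) measurable_majorant). Qed.

(** Boundedness of [W] gives [W x]^ q <= majorant_sup [^ (q - 1) * W x] for [q >= 1]. *)
Lemma integral_majorant_powR_lty q : 1 <= q -> (\int[leb]_x (W x `^ q)%:E < +oo)%E.
Proof.
move=> q1; apply: (@le_lt_trans _ _ (\int[leb]_x (majorant_sup `^ (q - 1) * W x)%:E)%E).
  apply: ge0_le_integral_nonmeasurable => x _; first by rewrite lee_fin powR_ge0.
  rewrite lee_fin -[in leLHS](subrK 1 q) powRD; last first.
    by rewrite subrK (gt_eqF (lt_le_trans ltr01 q1)).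
  rewrite powRr1 ?majorant_ge0// ler_wpM2r ?majorant_ge0// ge0_ler_powR ?subr_ge0//.
  - exact: majorant_ge0.
  - by rewrite nnegrE (ltW majorant_sup_gt0).
  - exact: majorant_le.
apply: integrable_lty => //; exact: (integrableZl measurableT _ integrable_majorant).
Qed.

End majorant.

Section unit_box.
Context {R : realType} {d : nat}.
Local Notation leb := (@lebesgue_rV R d).
Local Notation width := (@width R d).

(** The cube [1, 2]^d avoids coordinates equal to 0, where [kern] has its separate value, and keeps
    [width] times a coordinate within [0, pi], where cosine decreases. *)
Definition box : set 'rV[R]_d := [set x | forall i, 1 <= x ord0 i <= 2].

Lemma indic_box x : \1_box x = tensor (fun=> (\1_`[1, 2] : R -> R)) x.
Proof.
rewrite /tensor indicE; case: (boolP (x \in box)) => [|].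
  rewrite inE => xb; rewrite big1// => i _; rewrite indicE mem_set//= in_itv/=.
  exact: xb.
rewrite notin_setE => /existsNP[i xi].
by rewrite (bigD1 i)//= indicE memNset ?mul0r//= in_itv/=.
Qed.

Lemma measurable_box : measurable box.
Proof.
apply/(measurable_indicP R).
rewrite (_ : \1_box = tensor (fun=> (\1_`[1, 2] : R -> R))); last exact/funext/indic_box.
by apply: measurable_tensor => i; exact: measurable_indic.
Qed.

Lemma lebesgue_box : leb box = 1%E.
Proof.
have ind : (@lebesgue_measure R).-integrable setT (EFin \o \1_`[1%R, 2%R]).
  exact: (@integrable_indic_itv _ 1 2 true false).
have iT : leb.-integrable setT (EFin \o tensor (fun=> (\1_`[1%R, 2%R] : R -> R))).
  by apply: integrable_tensor.
rewrite -[box]setIT -integral_indic//; last exact: measurable_box.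
under eq_integral do rewrite indic_box.
rewrite -[LHS]fineK; last exact: integrable_fin_num.
congr EFin.
(* With zero frequencies and zero phase the cosine formula for tensor products computes a volume. *)
have := @Rintegral_tensor_cos R d (fun=> \1_`[1%R, 2%R]) (fun=> 0) (fun=> 1) (fun=> 0) 0.
rewrite !big1_eq addr0 cos0 mulr1 => H; rewrite -[RHS]H//.
  apply: eq_Rintegral => x _; rewrite big1 ?addr0 ?cos0 ?mulr1// => i _.
  by rewrite mul0r.
move=> _ b; rewrite addr0 mul1r.
under eq_Rintegral do rewrite mul0r addr0.
have L : @lebesgue_measure R `[1%R, 2%R] = 1%E.
  rewrite lebesgue_measure_itv/= lte_fin ltr1n/= -EFinB.
  by congr EFin; ring.
rewrite RintegralZr// /Rintegral integral_indic// setIT.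
by rewrite [X in fine X]L mul1r.
Qed.

Definition kern_low : R := fejer_mass * ((1 - cos width) / (4 * pi)).

Lemma kern_low_gt0 : (0 < d)%N -> 0 < kern_low.
Proof.
move=> d0; rewrite mulr_gt0 ?fejer_mass_gt0// divr_gt0 ?mulr_gt0 ?pi_gt0//.
have w0 : 0 < width by rewrite invr_gt0 mulr_gt0// ltr0n.
have w1 : width <= 1 by rewrite invf_le1 ?mulr_gt0 ?ltr0n// -natrM ler1n muln_gt0.
have pi2 := pi_ge2 R.
by rewrite subr_gt0 -[ltRHS]cos0 ltr_cos ?in_itv//=; lra.
Qed.

Lemma kern_rV_ge_low x : (0 < d)%N -> box x -> kern_low ^+ d <= kern_rV width x.
Proof.
move=> d0 bx; rewrite -[X in _ ^+ X](card_ord d) -prodr_const; apply: ler_prod => i _.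
rewrite (ltW (kern_low_gt0 d0))/=; have /andP[x1 x2] := bx i.
set t := x ord0 i in x1 x2 *.
have w0 : 0 < width by rewrite invr_gt0 mulr_gt0// ltr0n.
have w1 : width <= 1 by rewrite invf_le1 ?mulr_gt0 ?ltr0n// -natrM ler1n muln_gt0.
have pi2 := pi_ge2 R.
rewrite /kern_low /kern gt_eqF; last by lra.
rewrite ler_wpM2l ?(ltW fejer_mass_gt0)//.
apply: ler_pM; rewrite ?one_sub_cos_ge0 ?invr_ge0 ?mulr_ge0 ?pi_ge0//.
  rewrite lerD2l lerN2; move: x1; rewrite le_eqVlt => /predU1P[<-|x1]; first by rewrite mulr1.
  by rewrite ltW// ltr_cos ?in_itv/=; nra.
have t0 : 0 < t by lra.
rewrite mulrC lef_pV2 ?posrE ?mulr_gt0 ?pi_gt0 ?exprn_gt0//.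
rewrite ler_wpM2l ?pi_ge0//; nra.
Qed.

End unit_box.

(** * The two quasi-norms of a lacunary series *)

Lemma tl_fun_ge0 {R : realType} d (phi : 'rV[R]_d -> R[i]) s r f x :
  (0 < r)%E -> (0 <= tl_fun phi s r f x)%E.
Proof.
case: r => [r||] // _; first exact: poweR_ge0.
apply: le_trans (ereal_sup_ubound _); last by exists 0.
by rewrite lee_fin mulr_ge0 ?powR_ge0 ?normc_ge0.
Qed.

Lemma le_poweR {R : realType} (x y : \bar R) (r : R) :
  0 <= r -> (0 <= x)%E -> (x <= y)%E -> (x `^ r <= y `^ r)%E.
Proof.
move=> r0 x0 xy; apply: gt0_ler_poweR => //; rewrite in_itv/= ?x0 leey//.
by rewrite (le_trans x0 xy).
Qed.

Section lacunary_spaces.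
Context {R : realType} {d : nat} (i0 : 'I_d) (phi : 'rV[R]_d -> R[i]) (hphi : lp_cutoff phi).
Variables (s : R) (c : nat -> R) (M : nat).
Hypotheses (c0 : forall n, 0 <= c n) (c1 : forall n, c n <= 1).
Local Notation leb := (@lebesgue_rV R d).
Local Notation f := (lacunary i0 s c M).
Local Notation E n := (envelope i0 M n).
Local Notation W := (@majorant R d M).

Lemma term_ge0 n x : 0 <= c n * E n x.
Proof. by rewrite mulr_ge0// envelope_ge0. Qed.

Lemma measurable_term n : measurable_fun setT (fun x => c n * E n x).
Proof. by apply: measurable_funM => //; exact: measurable_envelope. Qed.

Lemma term_le_majorant n x : c n * E n x <= c n * W x.
Proof. by rewrite ler_wpM2l// envelope_le. Qed.

Lemma tl_fun_lacunary r x : 0 < r ->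
  tl_fun phi s r%:E f x = ((\sum_(0 <= n <oo) ((c n * E n x) `^ r)%:E) `^ r^-1)%E.
Proof.
move=> r0; rewrite /tl_fun; congr (_ `^ _)%E.
rewrite esum_int.
- apply: eq_eseriesr => n _; congr EFin.
  rewrite -(normc_LP_lacunary i0 hphi s M c0) powRM ?powR_ge0 ?normc_ge0//.
  by rewrite (powRrM _ (_ * s)).
- by move=> k; rewrite lee_fin mulr_ge0// powR_ge0.
- by move=> n; rewrite LP_lacunary_Negz// normc0 powR0 ?mulr0// gt_eqF.
Qed.

Lemma tl_fun_lacunary_pinfty x : (tl_fun phi s +oo%E f x <= (W x)%:E)%E.
Proof.
apply: ge_ereal_sup => _ [k _ <-]; rewrite lee_fin; case: k => n.
  rewrite (normc_LP_lacunary i0 hphi s M c0) (le_trans (term_le_majorant _ _))//.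
  by rewrite ler_piMl// majorant_ge0.
by rewrite LP_lacunary_Negz// normc0 mulr0 majorant_ge0.
Qed.

Section levels.
Variable p : R.
Local Notation F := (LPb phi (s + 0 / p) f).

Lemma normc_LPb n x : normc (F (x, n%:Z)) = c n * E n x.
Proof.
rewrite [F _](_ : _ = (2 `^ (n%:R * (s + 0 / p)))%:C * LP phi n f x)//.
rewrite mul0r addr0 normcM normc_real ger0_norm ?powR_ge0//.
exact: (normc_LP_lacunary i0 hphi s M c0).
Qed.

Lemma LPb_Negz n x : F (x, Negz n) = 0.
Proof. by rewrite /LPb /= LP_lacunary_Negz// mulr0. Qed.

Lemma cmeasurable_LPb : cmeasurable F.
Proof.
apply: cmeasurable_slices => -[n|n]; last first.
  rewrite (_ : (fun x => _) = (fun=> 0)); first exact: cmeasurable_cst.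
  by apply/funext => x; exact: LPb_Negz.
rewrite (_ : (fun x => _) = (fun x => (2 `^ (n%:R * (s + 0 / p)))%:C *
   ((amplitude s c n * E n x)%:C * cexpi (2 * pi * dotp x (freq i0 n))))).
  apply: cmeasurableM; first exact: cmeasurable_cst.
  apply: cmeasurableM.
    by apply: cmeasurable_real; apply: measurable_funM => //; exact: measurable_envelope.
  apply: cmeasurable_cexpi; apply: measurable_funM => //.
  by under eq_fun do rewrite dotpC; exact: measurable_dotp1.
by apply/funext => x; rewrite /LPb LP_lacunary.
Qed.

Lemma mu_gamma_level l : 0 < l ->
  mu_gamma 0 [set z | l < normc (F z)] = (\sum_(0 <= n <oo) leb [set x | (l < c n * E n x)%R])%E.
Proof.
move=> l0; rewrite /mu_gamma esum_int.
- apply: eq_eseriesr => n _; rewrite mulr0 oppr0 powRr0 mul1e; congr (leb _).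
  by apply: eq_set => x; rewrite -normc_LPb.
- by move=> k; rewrite mule_ge0// lee_fin powR_ge0.
- move=> n; rewrite (_ : [set x | _] = set0) ?measure0 ?mule0//.
  by apply/seteqP; split => x //; rewrite /mkset LPb_Negz normc0 ltNge (ltW l0).
Qed.

Lemma measurable_level n l : measurable [set x | (l < c n * E n x)%R].
Proof.
rewrite -[X in measurable X]setTI.
have : measurable_fun setT (fun x => l < c n * E n x).
  by apply: measurable_fun_ltr => //; exact: measurable_term.
by move=> /(_ measurableT [set true] I).
Qed.

Let k := @kern_low R d ^+ d.

(** Each of the first [N] terms exceeds [l] on all of [box], which has measure 1, and the weights of
    the measure are 1 for gamma = 0. *)
Lemma mu_gamma_level_ge N (l : R) : (0 < d)%N -> 0 < l ->
  (forall n, (n < N)%N -> l < c n * k) ->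
  (N%:R%:E <= mu_gamma 0 [set z | (l < normc (F z))%R])%E.
Proof.
move=> d0 l0 lk; rewrite mu_gamma_level//.
apply: le_trans (@nneseries_lim_ge R _ predT 0 N (fun n _ _ => measure_ge0 _ _)).
have -> : (N%:R%:E = \sum_(0 <= i < N) (1 : \bar R))%E.
  by rewrite sumEFin big_mkord sumr_const card_ord.
rewrite !big_mkord; apply: lee_sum => i _; rewrite -(@lebesgue_box R d); apply: le_measure.
- by rewrite inE; exact: measurable_box.
- by rewrite inE; exact: measurable_level.
- move=> x bx; apply: lt_le_trans (lk i (ltn_ord i)) _.
  by rewrite ler_wpM2l// (le_trans (kern_rV_ge_low d0 bx))// envelope_ge.
Qed.

Lemma lorentz_qnorm_pinfty_ge N (l : R) : 0 < p -> (0 < d)%N -> 0 < l ->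
  (forall n, (n < N)%N -> l < c n * k) ->
  ((l * N%:R `^ p^-1)%:E <= lorentz_qnorm (mu_gamma 0) p +oo F)%E.
Proof.
move=> p0 d0 l0 lk; have := mu_gamma_level_ge d0 l0 lk.
set m := mu_gamma 0 _ => Nm.
apply: (@le_trans _ _ (l%:E * m `^ p^-1)%E); last first.
  by apply: ereal_sup_ubound; exists l => //; rewrite /= in_itv/= l0.
rewrite EFinM -poweR_EFin lee_pmul2l ?lte_fin//.
by apply: le_poweR; rewrite ?invr_ge0 ?(ltW p0).
Qed.

End levels.

(** * Membership in the Triebel-Lizorkin space and failure of the weak Lorentz bound *)

Section first_part.
Variable p : R.
Hypothesis hp : 1 < p.

Lemma triebel_lizorkin_lacunary r C : schwartz_infty_dual f -> 0 <= C ->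
  (forall x, 0 <= tl_fun phi s r f x <= (C * W x)%:E)%E ->
  triebel_lizorkin phi s p r f.
Proof.
move=> fdual C0 fW; split=> //; rewrite unlock.
apply: poweR_lty.
apply: (@le_lt_trans _ _ (\int[leb]_x (C `^ p * W x `^ p)%:E)%E).
  apply: ge0_le_integral_nonmeasurable => x _; first exact: poweR_ge0.
  have /andP[f0 fCW] := fW x.
  rewrite gee0_abs// -powRM ?majorant_ge0// -poweR_EFin.
  by apply: gt0_ler_poweR; rewrite ?(ltW (lt_trans ltr01 hp))// in_itv/= ?f0 ?leey//
    lee_fin mulr_ge0 ?majorant_ge0.
under eq_integral do rewrite EFinM.
rewrite ge0_integralZl_EFin ?powR_ge0//.
- by rewrite lte_mul_pinfty ?lee_fin ?powR_ge0// integral_majorant_powR_lty// ltW.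
- by move=> x _; rewrite lee_fin powR_ge0.
- by apply/measurable_EFinP; exact: measurable_majorant_powR.
Qed.

Lemma lorentz_lacunary_pinfty a : (0 < d)%N -> 0 < a -> a < p^-1 ->
  (forall n, c n = n.+1%:R `^ (- a)) ->
  lorentz_qnorm (mu_gamma 0) p +oo (LPb phi (s + 0 / p) f) = +oo%E.
Proof.
move=> d0 a0 ap cE; have p0 : 0 < p by rewrite (lt_trans ltr01).
set k := @kern_low R d ^+ d; have k0 : 0 < k by rewrite exprn_gt0// kern_low_gt0.
have val N : ((k / 2 * N.+1%:R `^ (p^-1 - a))%:E <=
    lorentz_qnorm (mu_gamma 0) p +oo (LPb phi (s + 0 / p) f))%E.
  have N0 : 0 < N.+1%:R `^ (- a) :> R by rewrite powR_gt0.
  rewrite addrC powRD; last by rewrite pnatr_eq0 implybT.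
  rewrite mulrA; apply: lorentz_qnorm_pinfty_ge => // [|n nN].
    by rewrite mulr_gt0// divr_gt0.
  apply: (@lt_le_trans _ _ (k * N.+1%:R `^ (- a))); first by rewrite ltr_pM2r//; lra.
  rewrite mulrC ler_wpM2r ?(ltW k0)// cE !powRN lef_pV2 ?posrE ?powR_gt0//.
  by apply: ge0_ler_powR; rewrite ?nnegrE ?(ltW a0)// ler_nat.
move: val; set Q := lorentz_qnorm _ _ _ _ => val.
apply/eqP; rewrite eq_le leey/= leNgt; apply/negP => Qoo.
have Q0 : (0 <= Q)%E.
  by apply: le_trans (val 0); rewrite lee_fin mulr_ge0 ?powR_ge0// divr_ge0// ltW.
have Qfin : Q \is a fin_num by rewrite ge0_fin_numE.
set e := p^-1 - a in val; have e0 : 0 < e by rewrite subr_gt0.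
(* A finite [Q] would bound [N.+1%:R]^ e[by]fine Q / (k / 2)[for every]N[; the integer above]X
   [^ e^-1] contradicts this. *)
pose X := fine Q / (k / 2) + 1.
have k20 : 0 < k / 2 by rewrite divr_gt0.
have X0 : 0 <= X by rewrite addr_ge0// divr_ge0 ?fine_ge0// ltW.
have := val (Num.bound (X `^ e^-1)); rewrite -(fineK Qfin) lee_fin.
rewrite mulrC -ler_pdivlMr// leNgt => /negP; apply.
apply: (@lt_le_trans _ _ ((X `^ e^-1) `^ e)).
  by rewrite -powRrM mulVf ?gt_eqF// powRr1// ltrDl.
apply: ge0_ler_powR; rewrite ?nnegrE ?powR_ge0 ?(ltW e0)//.
rewrite (le_trans (ltW (archi_boundP _)))// ?powR_ge0// ler_nat.
exact: leqnSn.
Qed.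

Lemma triebel_lizorkin_lacunary_gt a r : schwartz_infty_dual f ->
  0 < r -> 1 < a * r -> (forall n, c n = n.+1%:R `^ (- a)) ->
  triebel_lizorkin phi s p r%:E f.
Proof.
move=> fdual r0 ar cE; pose S := (\sum_(0 <= n <oo) (c n `^ r)%:E)%E.
have S0 : (0 <= S)%E by apply: nneseries_ge0 => n _ _; rewrite lee_fin powR_ge0.
have Sfin : S \is a fin_num.
  rewrite ge0_fin_numE// /S; under eq_eseriesr do rewrite cE -powRrM mulNr.
  exact: nneseries_powR_lty.
apply: (triebel_lizorkin_lacunary (C := fine S `^ r^-1)) => // [|x]; first exact: powR_ge0.
rewrite tl_fun_ge0// andTb tl_fun_lacunary//.
apply: (@le_trans _ _ (((W x `^ r)%:E * S) `^ r^-1)%E).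
  apply: le_poweR; first by rewrite invr_ge0 ltW.
    by apply: nneseries_ge0 => n _ _; rewrite lee_fin powR_ge0.
  rewrite /S -nneseriesZl => [|n _]; last by rewrite lee_fin powR_ge0.
  apply: lee_nneseries => n _; first by rewrite lee_fin powR_ge0.
  rewrite -EFinM lee_fin (mulrC (W x `^ r)) -powRM ?majorant_ge0//.
  apply: ge0_ler_powR; first exact: ltW.
  - by rewrite nnegrE term_ge0.
  - by rewrite nnegrE mulr_ge0// majorant_ge0.
  - exact: term_le_majorant.
rewrite -[in leLHS](fineK Sfin) -EFinM poweR_EFin lee_fin powRM ?powR_ge0 ?fine_ge0//.
by rewrite -powRrM mulfV ?gt_eqF// powRr1 ?majorant_ge0// mulrC.
Qed.

End first_part.

(** * Membership in the Lorentz-based space and failure of the Triebel-Lizorkin bound *)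

Section second_part.
Variables t p : R.
Hypotheses (t1 : 1 <= t) (tp : t < p) (cE : forall n, c n = n.+1%:R `^ (- t^-1)).
Local Notation F := (LPb phi (s + 0 / p) f).

Let t0 : 0 < t. Proof. exact: lt_le_trans t1. Qed.
Let p0 : 0 < p. Proof. exact: lt_trans tp. Qed.

(** For fixed x, c_n W(x) > l means n + 1 < (W(x) / l)^t, so at most (W(x) / l)^t indices qualify.
    Exchanging sum and integral bounds the measure by l^(-t) times the integral of W^t, finite
    because [t >= 1]. *)
Lemma mu_gamma_level_le : exists2 B, 0 <= B & forall l : R, 0 < l ->
  (mu_gamma 0 [set z | (l < normc (F z))%R] <= (B * l `^ (- t))%:E)%E.
Proof.
have I0 : (0 <= \int[leb]_x (W x `^ t)%:E)%E.
  by apply: integral_ge0 => x _; rewrite lee_fin powR_ge0.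
have Ifin : (\int[leb]_x (W x `^ t)%:E)%E \is a fin_num.
  by rewrite ge0_fin_numE// integral_majorant_powR_lty.
exists (fine (\int[leb]_x (W x `^ t)%:E)); first exact: fine_ge0.
move=> l l0; rewrite mu_gamma_level// mulrC EFinM fineK//.
rewrite -ge0_integralZl_EFin ?powR_ge0//; last 2 first.
- by move=> x _; rewrite lee_fin powR_ge0.
- by apply/measurable_EFinP; exact: measurable_majorant_powR.
under eq_eseriesr => n _.
  rewrite -[X in leb X]setIT -integral_indic//; last exact: measurable_level.
  over.
rewrite -integral_nneseries//; last first.
  by move=> n; apply/measurable_EFinP; apply: measurable_indic; exact: measurable_level.
apply: ge0_le_integral_nonmeasurable => x _; first by apply: nneseries_ge0.
apply: le_trans (nneseries_count_le _); last first.
  by rewrite mulr_ge0 ?powR_ge0//.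
apply: lee_nneseries => n _; first by [].
rewrite lee_fin indicE; case: (boolP (x \in _)) => [|_]; last by [].
rewrite inE => /lt_le_trans /(_ (term_le_majorant n x)); rewrite cE => lW.
suff -> : n.+1%:R < l `^ (- t) * W x `^ t by [].
have n1 : (n.+1%:R = (n.+1%:R `^ t^-1) `^ t :> R).
  by rewrite -powRrM mulVf ?gt_eqF// powRr1.
rewrite [ltLHS]n1 powRN mulrC ltr_pdivlMr ?powR_gt0// -powRM ?powR_ge0 ?(ltW l0)//.
apply: gt0_ltr_powR => //.
- by rewrite nnegrE mulr_ge0 ?powR_ge0// ltW.
- by rewrite nnegrE majorant_ge0.
- by rewrite mulrC -ltr_pdivlMr ?powR_gt0// mulrC -powRN.
Qed.

Lemma mu_gamma_level_eq0 (l : R) : @majorant_sup R d M <= l ->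
  mu_gamma 0 [set z | (l < normc (F z))%R] = 0%E.
Proof.
move=> sl; rewrite mu_gamma_level; last by rewrite (lt_le_trans _ sl)// majorant_sup_gt0.
rewrite eseries0// => n _ _.
rewrite (_ : [set x | _] = set0) ?measure0//.
apply/seteqP; split => x //; rewrite /mkset ltNge => /negP; apply.
rewrite (le_trans (term_le_majorant n x))// (le_trans _ sl)//.
by rewrite (le_trans _ (majorant_le M x))// ler_piMl// majorant_ge0.
Qed.

(** For second index 1 the factors [l] and [l^-1] cancel. What remains is at most a multiple of
    l^(-t/p), integrable near 0 as [t < p], and it vanishes from [majorant_sup] on, where the level
    sets are empty. *)
Lemma lorentz_lacunary_1 : lorentz (mu_gamma 0) p 1%:E F.
Proof.
have [mre mim] := cmeasurable_LPb p; split=> //.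
have [B B0 HB] := mu_gamma_level_le.
rewrite /lorentz_qnorm; apply: poweR_lty; rewrite mul1e.
set A := @majorant_sup R d M; have A0 : 0 < A by exact: majorant_sup_gt0.
pose g l := (B `^ (1 / p) * l `^ (- (t / p)))%:E.
apply: (@le_lt_trans _ _ (\int[lebesgue_measure]_(l in `]0%R, +oo[) (g \_ `]0%R, A]) l)%E).
  apply: ge0_le_integral_nonmeasurable => l; rewrite /= in_itv/= andbT => l0.
    by rewrite !mule_ge0 ?poweR_ge0// lee_fin ?powR_ge0// invr_ge0 ltW.
  rewrite patchE; case: ifPn => [|/negP lA].
    rewrite inE/= in_itv/= => /andP[_ lA].
    rewrite muleAC -EFinM powRr1 ?(ltW l0)// mulfV ?gt_eqF// mul1e.
    apply: (@le_trans _ _ ((B * l `^ (- t))%:E `^ (1 / p))%E).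
      by apply: le_poweR; rewrite ?divr_ge0 ?(ltW p0)//; exact: HB.
    by rewrite poweR_EFin lee_fin powRM ?powR_ge0// -powRrM mul1r mulNr.
  rewrite mu_gamma_level_eq0.
    by rewrite poweR0r ?mule0 ?mul0e// mul1r invr_neq0// gt_eqF.
  rewrite leNgt; apply/negP => lA'; apply: lA.
  by rewrite inE/= in_itv/= l0 ltW.
rewrite -integral_mkcondr (_ : _ `&` _ = `]0%R, A]%classic); last first.
  by apply/seteqP; split=> l; rewrite /= !in_itv/= andbT; [case|move=> /andP[-> ->]].
under eq_integral do rewrite /g EFinM.
rewrite ge0_integralZl_EFin ?powR_ge0//.
- rewrite lte_mul_pinfty ?lee_fin ?powR_ge0// integral_powR_lty//.
  by rewrite divr_ge0 ?(ltW t0) ?(ltW p0)//= ltr_pdivrMr// mul1r.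
- by move=> l _; rewrite lee_fin powR_ge0.
- by apply: measurable_funTS; apply/measurable_EFinP; exact: measurable_powR.
Qed.

Lemma tl_fun_lacunary_box r x : (0 < d)%N -> 0 < r -> r <= t -> box x ->
  tl_fun phi s r%:E f x = +oo%E.
Proof.
move=> d0 r0 rt bx; rewrite tl_fun_lacunary//.
set k := @kern_low R d ^+ d; have k0 : 0 < k by rewrite exprn_gt0// kern_low_gt0.
rewrite [X in (X `^ _)%E](_ : _ = +oo%E); last first.
  apply/eqP; rewrite eq_le leey/=.
  apply: (@le_trans _ _ (\sum_(0 <= n <oo) ((k `^ r)%:E * (n.+1%:R `^ (- (r / t)))%:E))%E).
    rewrite nneseriesZl => [|n _]; last by rewrite lee_fin powR_ge0.
    rewrite nneseries_powR_pinfty ?gt0_muley ?lte_fin ?powR_gt0//.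
    by rewrite divr_ge0 ?(ltW r0) ?(ltW t0)//= ler_pdivrMr// mul1r.
  apply: lee_nneseries => n _; first by rewrite -EFinM lee_fin mulr_ge0 ?powR_ge0.
  rewrite -EFinM lee_fin cE [in leRHS]powRM ?powR_ge0 ?envelope_ge0//.
  rewrite -powRrM mulNr (mulrC t^-1) (mulrC (k `^ r)) ler_wpM2l ?powR_ge0//.
  apply: ge0_ler_powR; rewrite ?nnegrE ?envelope_ge0 ?(ltW r0) ?(ltW k0)//.
  by rewrite (le_trans (kern_rV_ge_low d0 bx))// envelope_ge.
by rewrite poweRyr// invr_neq0// gt_eqF.
Qed.

Lemma not_triebel_lizorkin_lacunary r : (0 < d)%N -> 0 < r -> r <= t ->
  ~ triebel_lizorkin phi s p r%:E f.
Proof.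
move=> d0 r0 rt [_]; move: (fun x => tl_fun_lacunary_box (x := x) d0 r0 rt).
move: (tl_fun _ _ _ _) => G Goo; rewrite unlock.
rewrite [X in (X `^ _)%E](_ : _ = +oo%E); last first.
  apply/eqP; rewrite eq_le leey/=.
  apply: (@le_trans _ _ (\int[leb]_x (cst +oo%E \_ box) x)%E).
    rewrite -integral_mkcond integral_cst; last exact: measurable_box.
    by rewrite [X in (_ * X)%E]lebesgue_box mule1.
  apply: ge0_le_integral_nonmeasurable => x _; rewrite patchE; case: ifPn => [xb|_].
  - exact: leey.
  - exact: lexx.
  - by move: xb; rewrite inE => /Goo ->; rewrite poweRyr// gt_eqF.
  - exact: poweR_ge0.
by rewrite poweRyr// invr_neq0// gt_eqF.
Qed.

End second_part.
End lacunary_spaces.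

Theorem theorem1p6 (R : realType) (d : nat) (hd : (0 < d)%N)
    (phi : 'rV[R]_d -> R[i]) (hphi : lp_cutoff phi)
    (s p : R) (hp : 1 < p) :
  (forall r : \bar R, (p%:E < r)%E ->
    triebel_lizorkin phi s p r `\` besov_lorentz phi s p 0 +oo%E !=set0) /\
  (forall r : R, 0 < r -> r < p ->
    besov_lorentz phi s p 0 1%:E `\` triebel_lizorkin phi s p r%:E !=set0).
Proof.
have p0 : 0 < p by exact: lt_trans hp.
pose i0 := Ordinal hd; pose M := Num.bound `|1 - s|.
have sM : 1 - s <= M%:R.
  by rewrite (le_trans (ler_norm _))// ltW// archi_boundP.
pose c a n : R := n.+1%:R `^ (- a).
have c0 a n : 0 <= c a n by exact: powR_ge0.
have c1 a n : 0 <= a -> c a n <= 1.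
  by move=> a0; rewrite -[leRHS](powRr0 n.+1%:R) ler_powR ?ler1n// oppr_le0.
have dual a : 0 <= a -> schwartz_infty_dual (lacunary i0 s (c a) M).
  by move=> a0; apply: lacunary_dual => // n; exact: c1.
split=> [r pr|r r0 rp].
  have [a [a0 ap fr]] : exists a, [/\ 0 < a, a < p^-1 &
      triebel_lizorkin phi s p r (lacunary i0 s (c a) M)].
    case: r pr => [r||]// => [|_].
      rewrite lte_fin => pr; have r0 : 0 < r by exact: lt_trans pr.
      have rp : r^-1 < p^-1 by rewrite ltf_pV2.
      (* The decay exponent of [c] is the midpoint of 1/r and 1/p: above 1/r for l^r summability,
         below 1/p for failure of the weak l^p bound. *)
      have ra : r^-1 < (r^-1 + p^-1) / 2 by lra.
      have a0 : 0 < (r^-1 + p^-1) / 2 by rewrite (lt_trans _ ra)// invr_gt0.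
      exists ((r^-1 + p^-1) / 2); split=> //; first by lra.
      apply: (triebel_lizorkin_lacunary_gt hphi (c0 _) hp
        (dual _ (ltW a0)) r0 _ (fun=> erefl)).
      by rewrite -ltr_pdivrMr// mul1r.
    (* For [r = +oo] boundedness of [c] suffices on the Triebel-Lizorkin side, so any exponent in
       (0, 1/p) would serve. *)
    have a0 : 0 < p^-1 / 2 by rewrite divr_gt0// invr_gt0.
    exists (p^-1 / 2); split=> //; first by lra.
    have c1a n : c (p^-1 / 2) n <= 1 by exact/c1/ltW.
    apply: (triebel_lizorkin_lacunary hp (dual _ (ltW a0)) ler01) => x.
    by rewrite mul1r tl_fun_ge0// (tl_fun_lacunary_pinfty i0 hphi s M (c0 _) c1a).
  exists (lacunary i0 s (c a) M); split=> // -[_ [_ _]].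
  by rewrite (lorentz_lacunary_pinfty i0 hphi s M (c0 _) hp hd a0 ap (fun=> erefl)).
(* The decay exponent 1/t must exceed 1/p and make the r-th powers of [c] non-summable, which asks
   for [r <= t < p]; the maximum with 1 keeps W^t integrable when [r < 1]. *)
pose t := Num.max 1 r.
have t1 : 1 <= t by rewrite le_max lexx.
have tp : t < p by rewrite gt_max hp.
have t0 : 0 <= t^-1 by rewrite invr_ge0 (le_trans ler01).
have c1t n : c t^-1 n <= 1 by exact: c1.
exists (lacunary i0 s (c t^-1) M); split.
  by split; [exact: dual|exact: (lorentz_lacunary_1 i0 hphi s M (c0 _) c1t t1 tp (fun=> erefl))].
apply: (not_triebel_lizorkin_lacunary hphi (c0 _) t1 tp (fun=> erefl) hd r0).
by rewrite le_max lexx orbT.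
Qed.
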